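(* Let $\beta,L,\Lambda,K,\Sigma,\Gamma>0$. Let $w:\mathbb{R}\to\mathbb{R}$ be continuous, supported on $[-1,1]$, with $$\int_{-1}^1 t\,w(t)\,dt=1,\qquad w(t)=O(|t|^{\beta})\ \text{ as } t\to0,$$ and put $w^h(t)=h^2w(ht)$. Let $h=h_n=(\eta\log n)^{-1/2}$ with $0<\eta<\Sigma^{-2}$, and let $M_n=m_nh_n^{-2}$ be positive numbers, where $(m_n)$ is a sequence of real numbers diverging to $+\infty$ at a slower rate than $\log n$ (i.e. $m_n=o(\log n)$). Define the estimator $$\tilde\gamma_n=\int_{-1/h}^{1/h}\max\{\min\{\Im(\operatorname{Log}(\phi_{emp}(t))),M_n\},-M_n\}\,w^h(t)\,dt .$$ Then there exist a constant $A>0$ and an integer $n_0$ such that for all $n\ge n_0$ $$\sup_{|\gamma|\le\Gamma}\ \sup_{\sigma\in(0,\Sigma]}\ \sup_{\rho\in W_{sym}(\beta,L,\Lambda,K)}\operatorname{E}\bigl[(\tilde\gamma_n-\gamma)^2\bigr]\le A(\log n)^{-\beta-2}.$$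
   Context: For $\gamma\in\mathbb{R}$, $\sigma\ge0$ and a Lévy density $\rho:\mathbb{R}\to[0,\infty)$ with $0<\lambda:=\int_{-\infty}^{\infty}\rho(x)\,dx<\infty$, let $X_1,\dots,X_n$ be i.i.d. copies of a random variable $X$ with characteristic function $$\phi_X(t)=\exp\Bigl[i\gamma t-\tfrac12\sigma^2t^2+\int_{\mathbb{R}}(e^{itx}-1)\rho(x)\,dx\Bigr].$$ Expectations are taken under the law determined by $(\gamma,\sigma^2,\rho)$. Write $f=\rho/\lambda$ (a probability density), $\phi_f(t)=\int e^{itx}f(x)\,dx$, and $\phi_{emp}(t)=\frac1n\sum_{j=1}^n e^{itX_j}$ for the empirical characteristic function. Define $$W(\beta,L,\Lambda,K)=\Bigl\{\rho:\ \rho=\lambda f,\ f\text{ a probability density},\ \int_{-\infty}^{\infty}x^2f(x)\,dx\le K,\ \int_{-\infty}^{\infty}|t|^\beta|\phi_f(t)|\,dt\le L,\ \lambda\in(0,\Lambda]\Bigr\},$$ and let $W_{sym}(\beta,L,\Lambda,K)$ be the set of symmetric (even) $\rho\in W(\beta,L,\Lambda,K)$. $\operatorname{Log}$ denotes the distinguished logarithm: if $\phi_{emp}$ does not vanish on $[-h^{-1},h^{-1}]$, then $\operatorname{Log}(\phi_{emp}(t))$ is the unique continuous function of $t\in[-h^{-1},h^{-1}]$ with $\exp(\operatorname{Log}(\phi_{emp}(t)))=\phi_{emp}(t)$ and $\operatorname{Log}(\phi_{emp}(0))=0$. For those sample points $\omega$ for which $\phi_{emp}$ vanishes somewhere on $[-h^{-1},h^{-1}]$,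 an arbitrary fixed value, e.g. zero, is assigned to $\operatorname{Log}(\phi_{emp}(t))$ in the definition of $\tilde\gamma_n$. The constants $A,n_0$ do not depend on $n$ or on $(\gamma,\sigma,\rho)$ in the indicated classes (they may depend on the class parameters, $\eta$, $(m_n)$ and $w$). *)

(* Defs.v *)
From HB Require Import structures.
From mathcomp Require Import all_boot all_order all_algebra.
From mathcomp Require Import complex.
From mathcomp Require Import all_classical all_reals all_analysis.

Set Implicit Arguments.
Unset Strict Implicit.
Unset Printing Implicit Defensive.

Import Order.TTheory GRing.Theory Num.Theory.
Import numFieldNormedType.Exports.

Local Open Scope classical_set_scope.
Local Open Scope ring_scope.
Local Open Scope complex_scope.

Section ComplexValued.
Context {R : realType}.

Definition cexp (z : R[i]) : R[i] :=
  (expR (complex.Re z))%:C * (cos (complex.Im z) +i* sin (complex.Im z)).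

Definition Cintegral d (T : measurableType d) (mu : {measure set T -> \bar R})
    (D : set T) (f : T -> R[i]) : R[i] :=
  Rintegral mu D (fun x => complex.Re (f x)) +i*
  Rintegral mu D (fun x => complex.Im (f x)).

Definition charfun (mu : probability R R) (t : R) : R[i] :=
  Cintegral mu setT (fun x => cexp ((t * x) *i)).

(* In R[i] the norm `|z| is itself a complex number, hence the projection. *)
Definition cmodulus (z : R[i]) : R := complex.Re `|z|.

End ComplexValued.

Section LevyModel.
Context {R : realType}.
Local Notation mu := (@lebesgue_measure R).

Definition levy_charfun (gamma sigma : R) (rho : R -> R) (t : R) : R[i] :=
  cexp ((gamma * t) *i - (2^-1 * sigma ^+ 2 * t ^+ 2)%:C
        + Cintegral mu setT (fun x => (cexp ((t * x) *i) - 1) * (rho x)%:C)).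

Definition is_density (f : R -> R) : Prop :=
  [/\ measurable_fun setT f, forall x, 0 <= f x
    & (\int[mu]_(x in setT) (f x)%:E = 1)%E].

Definition density_charfun (f : R -> R) (t : R) : R[i] :=
  Cintegral mu setT (fun x => cexp ((t * x) *i) * (f x)%:C).

Definition W (beta L Lambda K : R) : set (R -> R) :=
  [set rho | exists (lam : R) (f : R -> R),
    [/\ rho = (fun x => lam * f x),
        is_density f,
        (\int[mu]_(x in setT) (x ^+ 2 * f x)%:E <= K%:E)%E,
        (\int[mu]_(t in setT)
           (`|t| `^ beta * cmodulus (density_charfun f t))%:E <= L%:E)%E
      & 0 < lam <= Lambda]].

Definition W_sym (beta L Lambda K : R) : set (R -> R) :=
  [set rho | W beta L Lambda K rho /\ forall x, rho (- x) = rho x].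

End LevyModel.

Section Sample.
Context {R : realType} d {T : measurableType d} {P : probability T R}.

(* Taking some of the B i to be setT gives the product rule for subfamilies. *)
Definition mutually_independent n (X : 'I_n -> {RV P >-> R}) : Prop :=
  forall B : 'I_n -> set R, (forall i, measurable (B i)) ->
    P (\bigcap_i (X i @^-1` B i)) = (\prod_(i < n) P (X i @^-1` B i))%E.

Definition iid_sample n (nu : probability R R) (X : 'I_n -> {RV P >-> R}) : Prop :=
  mutually_independent X /\
  forall i (A : set R), measurable A -> distribution P (X i) A = nu A.

End Sample.

Section Estimator.
Context {R : realType}.
Local Notation mu := (@lebesgue_measure R).

Definition empirical_charfun n (x : 'I_n -> R) (t : R) : R[i] :=
  n%:R^-1 * \sum_(j < n) cexp ((t * x j) *i).

Definition is_distinguished_log (r : R) (g l : R -> R[i]) : Prop :=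
  [/\ {within `[- r, r], continuous (l : R -> (R[i] : numFieldType))},
      forall t, t \in `[- r, r] -> cexp (l t) = g t
    & l 0 = 0].

(* Such an l is unique on [- r, r] only; xget selects some extension to R, and
   only the values on [- r, r] are used. The value c is taken if g vanishes. *)
Definition distinguished_log (c : R[i]) (r : R) (g : R -> R[i]) : R -> R[i] :=
  if `[< forall t, t \in `[- r, r] -> g t != 0 >]
  then xget (fun=> c) (is_distinguished_log r g)
  else fun=> c.

Definition rescaled (w : R -> R) (h t : R) : R := h ^+ 2 * w (h * t).

Definition gamma_tilde (w : R -> R) (h M : R) (c : R[i]) n (x : 'I_n -> R) : R :=
  \int[mu]_(t in `[- h^-1, h^-1])
    (Num.max (Num.min (complex.Im (distinguished_log c h^-1 (empirical_charfun x) t)) M) (- M)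
     * rescaled w h t).

Definition bandwidth (eta : R) (n : nat) : R := (eta * ln n%:R) `^ (- 2^-1).

End Estimator.

(* Main.v *)
Require Import Defs.
From HB Require Import structures.
From mathcomp Require Import all_boot all_order all_algebra.
From mathcomp Require Import complex ring lra.
From mathcomp Require Import all_classical all_reals all_analysis measurable_realfun.
Set Implicit Arguments.
Unset Strict Implicit.
Unset Printing Implicit Defensive.
Import Order.TTheory GRing.Theory Num.Theory.
Import numFieldNormedType.Exports.
Local Open Scope classical_set_scope.
Local Open Scope ring_scope.

(* For an even rho the imaginary part of the exponent of phi_X is exactly
   gamma t, so the estimator has no bias and only the deviation
   g = phi_emp - phi_X matters; relative to |phi_X| >= eps on [- h^-1, h^-1],
   with eps a constant times n^(- Sigma^2 eta / 2), it is polynomially small.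

   The characteristic function alone gives E |g t - g s|^2 <= V (t - s)^2 / n.
   Dyadic chaining bounds sup |g|^2 over [- h^-1, h^-1] by a multiple of a
   weighted sum S of squared dyadic increments of g, with E S <= 5 V h^-2 / n.
   If S is at most (eps / 20)^2, then phi_emp(t) e^(- i gamma t) stays in the
   right half-plane and Im (Log phi_emp) is gamma t plus an arctangent of size
   O (sqrt S / eps); otherwise the truncation at M_n gives a crude bound. Either
   way (gamma_tilde - gamma)^2 <= B_n S pointwise, where B_n is a power of ln n
   times eps^-2, and integrating this leaves a power of ln n times
   n^(Sigma^2 eta - 1). *)

(** * Elementary bounds for trigonometric functions *)

Lemma norm_le_of_derive_le1 (R : realType) (f df : R -> R) :
  f 0 = 0 -> (forall x, is_derive x (1 : R) f (df x)) -> (forall x, `|df x| <= 1) ->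
  forall x, `|f x| <= `|x|.
Proof.
move=> f0 fd df1 x.
have fc (a b : R) : {within `[a, b], continuous f}.
  apply: continuous_subspaceT => y; apply: differentiable_continuous.
  by apply/derivable1_diffP; have [] := fd y.
have [x0|/ltW x0] := leP 0 x.
- have [c _] := MVT_segment x0 (fun y _ => fd y) (fc _ _).
  rewrite f0 !subr0 => ->; rewrite normrM ler_piMl//.
- have [c _] := MVT_segment x0 (fun y _ => fd y) (fc _ _).
  rewrite f0 !sub0r => /eqP; rewrite -normrN => /eqP ->.
  by rewrite normrM normrN ler_piMl.
Qed.

Lemma norm_sin_le (R : realType) (x : R) : `|sin x| <= `|x|.
Proof. exact: (norm_le_of_derive_le1 (@sin0 R) (@is_derive_sin R) (@cos_max R)). Qed.

Lemma norm_atan_le (R : realType) (x : R) : `|atan x| <= `|x|.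
Proof.
apply: (norm_le_of_derive_le1 (@atan0 R) (@is_derive1_atan R)) => y.
rewrite ger0_norm ?invr_ge0 ?addr_ge0 ?sqr_ge0//.
by rewrite invf_le1 ?lerDl ?sqr_ge0// ltr_pwDl// sqr_ge0.
Qed.

(** Half-angle formula: [1 - cos x] is twice the square of [sin (x / 2)]. *)
Lemma one_sub_cos_le (R : realType) (x : R) : 1 - cos x <= x ^+ 2 / 2.
Proof.
have -> : x = x / 2 + x / 2 by field.
set y := x / 2; rewrite -[y + y]mulr2n cos_mulr2n cos2sin2 [y *+ 2]mulr2n.
have : sin y ^+ 2 <= y ^+ 2.
  by rewrite -real_normK ?num_real// -[leRHS]real_normK ?num_real// lerXn2r ?nnegrE ?norm_sin_le.
by rewrite [(1 - _) *+ 2]mulr2n; lra.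
Qed.

(** This is |e^(ix) - e^(iy)|^2. It depends on [x - y] only, so the mean squared increment of
    e^(itX) can be read off the real part of the characteristic function. *)
Lemma sqr_dist_cos_sin (R : realType) (x y : R) :
  (cos x - cos y) ^+ 2 + (sin x - sin y) ^+ 2 = 2 * (1 - cos (x - y)).
Proof.
rewrite cosB; have := cos2Dsin2 x; have := cos2Dsin2 y; nra.
Qed.

(** * Dyadic chaining *)

Section Chaining.
Variable R : realType.

Definition dyadic (k i : nat) : R := i%:R / 2 ^+ k.

Lemma dyadic_double k i : dyadic k.+1 i.*2 = dyadic k i.
Proof.
rewrite /dyadic exprS -muln2 natrM invfM; field.
by rewrite expf_neq0.
Qed.

(** A dyadic point of level [N.+1] has either an even index, and is then a point of level [N], or an
    odd one, and is then one increment to the right of such a point. Each level thus costs at most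
    one increment. *)
Lemma chaining_dyadic (g : R -> R) (s : R) : g 0 = 0 ->
  (forall k i, (i < 2 ^ k)%N ->
    `|g (dyadic k i.+1) - g (dyadic k i)| <= s * (4 / 5) ^+ k) ->
  forall N i, (i <= 2 ^ N)%N ->
    `|g (dyadic N i)| <= s * \sum_(k < N.+1) (4 / 5) ^+ k.
Proof.
move=> g0 ginc.
have s0 : 0 <= s.
  by have := ginc 0%N 0%N isT; rewrite expr0 mulr1; apply: le_trans.
have z0 k : g (dyadic k 0) = 0 by rewrite /dyadic mul0r.
elim=> [|N IH] i iN.
  rewrite big_ord1; case: i iN => [|[|//]] _; first by rewrite z0 normr0 expr0 mulr1.
  by have := ginc 0%N 0%N isT; rewrite z0 subr0.
rewrite big_ord_recr/= mulrDr.
have := odd_double_half i; case: (odd i) => /= iE; rewrite -iE.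
- have iN' : (i./2 < 2 ^ N)%N.
    by rewrite -ltn_double -(leq_add2l 1) add1n -[X in (X <= _)%N]/(1 + i./2.*2).+1 iE
      ltnS -mul2n -expnS.
  rewrite add1n -[g _](subrK (g (dyadic N.+1 i./2.*2))).
  rewrite (le_trans (ler_normD _ _))// addrC lerD//.
    by rewrite dyadic_double; apply: IH; exact: ltnW.
  by apply: ginc; rewrite expnS mul2n ltn_double.
- rewrite add0n dyadic_double (le_trans (IH _ _))//.
    by rewrite -leq_double -[leqRHS]mul2n -expnS -[leqLHS]add0n iE.
  by rewrite lerDl mulr_ge0// exprn_ge0//; lra.
Qed.

(** The geometric series of ratio 4/5 sums to 5, so all dyadic points obey the bound [5 * s];
    continuity carries it to every [t]. *)
Lemma chaining (g : R -> R) (s : R) : continuous g -> g 0 = 0 ->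
  (forall k i, (i < 2 ^ k)%N ->
    `|g (dyadic k i.+1) - g (dyadic k i)| <= s * (4 / 5) ^+ k) ->
  forall t, 0 <= t <= 1 -> `|g t| <= 5 * s.
Proof.
move=> gc g0 ginc t /andP[t0 t1].
have s0 : 0 <= s.
  by have := ginc 0%N 0%N isT; rewrite expr0 mulr1; apply: le_trans.
have sumle N : \sum_(k < N.+1) (4 / 5 : R) ^+ k <= 5.
  have : (1 - 4 / 5) * \sum_(k < N.+1) (4 / 5 : R) ^+ k <= 1.
    rewrite -[leLHS]opprK -mulNr opprB -subrX1 opprB gerBl exprn_ge0//; lra.
  by lra.
have dy_le N i : (i <= 2 ^ N)%N -> `|g (dyadic N i)| <= 5 * s.
  move=> iN; apply: (le_trans (chaining_dyadic g0 ginc iN)).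
  by rewrite mulrC ler_wpM2r.
(* [dyadic N (i N)] is the largest point of level [N] not exceeding [t]. *)
pose i N := Num.truncn (t * 2 ^+ N).
have p2 N : 0 < (2 : R) ^+ N by rewrite exprn_gt0.
have iN N : (i N <= 2 ^ N)%N.
  rewrite -(ler_nat R) natrX; apply: (@le_trans _ _ (t * 2 ^+ N)).
    by rewrite truncn_le mulr_ge0// ltW.
  by rewrite ler_piMl// ltW.
have cvi : dyadic N (i N) @[N --> \oo] --> t.
  apply/cvgrPdist_le => e e0; near=> N.
  have /andP[h1 h2] := truncn_itv (mulr_ge0 t0 (ltW (p2 N))).
  rewrite ler_norml; apply/andP; split.
    rewrite lerNl opprB (@le_trans _ _ 0) ?(ltW e0)// subr_le0 /dyadic ler_pdivrMr//.
  rewrite lerBlDr /dyadic (@le_trans _ _ (((i N)%:R + 1) / 2 ^+ N))//.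
    by rewrite ler_pdivlMr// natr1 ltW.
  rewrite mulrDl addrC lerD2r mul1r -exprVn; near: N.
  have /cvgrPdist_le/(_ _ e0) : (2^-1 : R) ^+ N @[N --> \oo] --> (0 : R).
    by apply: cvg_expr; rewrite ger0_norm ?invr_ge0// invf_lt1// ltr1n.
  by apply: filterS => N; rewrite sub0r normrN ger0_norm// exprn_ge0.
have cvi_norm : `|g (dyadic N (i N))| @[N --> \oo] --> `|g t|.
  by apply: cvg_norm; apply: continuous_cvg => //; exact: gc.
apply: (cvgr_to_le cvi_norm); apply: nearW => N; exact: dy_le.
Unshelve. all: by end_near.
Qed.

End Chaining.

(** * Integration on probability spaces *)

(* The squared error is not known to be a measurable function of the sample
   point; the integral of a nonnegative function is a supremum over its simple
   minorants, hence monotone regardless. *)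
Lemma ge0_le_integral_lower d (T : measurableType d) (R : realType)
    (mu : {measure set T -> \bar R}) (f g : T -> \bar R) :
  (forall x, (0 <= f x)%E) -> (forall x, (f x <= g x)%E) ->
  (\int[mu]_x f x <= \int[mu]_x g x)%E.
Proof.
move=> f0 fg; have g0 x : (0 <= g x)%E := le_trans (f0 x) (fg x).
rewrite !ge0_integralTE//; apply: le_ereal_sup => _ [h hf <-].
by exists h => // x; apply: le_trans (fg x); exact: hf.
Qed.

Lemma bounded_integrable d (T : measurableType d) (R : realType)
    (P : probability T R) (u : T -> R) (C : R) :
  measurable_fun setT u -> (forall x, `|u x| <= C) ->
  P.-integrable setT (EFin \o u).
Proof.
move=> mu uC; have Poo : (P setT < +oo)%E by rewrite probability_setT ltry.
apply: (measurable_bounded_integrable measurableT Poo mu).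
exists C; split; first exact: num_real.
by move=> M CM x _; apply: le_trans (uC x) (ltW CM).
Qed.

Lemma Rintegral_sum d (T : measurableType d) (R : realType)
    (mu : {measure set T -> \bar R}) (I : Type) (s : seq I) (F : I -> T -> R) :
  (forall i, mu.-integrable setT (EFin \o F i)) ->
  \int[mu]_x (\sum_(i <- s) F i x) = \sum_(i <- s) \int[mu]_x F i x.
Proof.
move=> Fi; rewrite /Rintegral.
under eq_integral do rewrite -sumEFin.
rewrite integral_sum//.
rewrite -[RHS]/(fine (\sum_(i <- s) fine (\int[mu]_x (F i x)%:E))%:E); congr fine.
by apply/esym/EFin_sum_fine => i _; apply: integrable_fin_num => //; exact: Fi.
Qed.

Lemma Rintegral_cst_probability d (T : measurableType d) (R : realType)
    (P : probability T R) (c : R) : \int[P]_x c = c.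
Proof.
have P1 : P setT = 1%E := probability_setT P.
by rewrite Rintegral_cst//= [X in fine X]P1 mulr1.
Qed.

Lemma Rintegral_sqr_sub_mean d (T : measurableType d) (R : realType)
    (P : probability T R) (u : T -> R) (C : R) (m := \int[P]_x u x) :
  measurable_fun setT u -> (forall x, `|u x| <= C) ->
  \int[P]_x ((u x - m) ^+ 2) = \int[P]_x (u x ^+ 2) - m ^+ 2.
Proof.
move=> mu uC; have ui := bounded_integrable P mu uC.
have mu2 : measurable_fun setT (fun x => u x ^+ 2) by exact: measurable_funX.
have u2i : P.-integrable setT (EFin \o (fun x => u x ^+ 2)).
  apply: (bounded_integrable P mu2 (C := C ^+ 2)) => x.
  by rewrite normrX lerXn2r// nnegrE (le_trans _ (uC x)).
have ci k := finite_measure_integrable_cst P k measurableT.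
have zi : P.-integrable setT (EFin \o (fun x => 2 * m * u x)).
  by have := integrableZl measurableT (2 * m) ui.
rewrite (_ : (fun x => (u x - m) ^+ 2) =
             (fun x => (u x ^+ 2 - (2 * m) * u x) + m ^+ 2)); last first.
  by apply/funext => x; ring.
rewrite (RintegralD measurableT (integrableB measurableT u2i zi) (ci (m ^+ 2))).
rewrite (RintegralB measurableT u2i zi) Rintegral_cst_probability RintegralZl// -/m.
by ring.
Qed.

(** Nonnegativity of the variance. *)
Lemma sqr_Rintegral_le d (T : measurableType d) (R : realType)
    (P : probability T R) (u : T -> R) (C : R) :
  measurable_fun setT u -> (forall x, `|u x| <= C) ->
  (\int[P]_x u x) ^+ 2 <= \int[P]_x (u x ^+ 2).
Proof.
move=> mu uC; rewrite -subr_ge0 -(Rintegral_sqr_sub_mean P mu uC).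
by apply: Rintegral_ge0 => x _; exact: sqr_ge0.
Qed.

(** * Variance of sample means *)

Section SampleMean.
Context (R : realType) d (T : measurableType d) (P : probability T R)
  (nu : probability R R) (n : nat) (X : 'I_n -> {RV P >-> R}).
Hypothesis iidX : iid_sample nu X.

(** Mutual independence is applied to the family equal to [A] at [i], to [B] at [j] and to the whole
    line elsewhere; the remaining factors are 1. *)
Lemma pair_law (i j : 'I_n) (A B : set R) : i != j ->
  measurable A -> measurable B ->
  P (X i @^-1` A `&` X j @^-1` B) = (nu A * nu B)%E.
Proof.
move=> ij mA mB; have [ind dist] := iidX.
pose D k : set R := if k == i then A else if k == j then B else setT.
have Di : D i = A by rewrite /D eqxx.
have Dj : D j = B by rewrite /D eq_sym (negbTE ij) eqxx.
have -> : X i @^-1` A `&` X j @^-1` B = \bigcap_k (X k @^-1` D k).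
  apply/seteqP; split => [w [Aw Bw] k _|w Dw].
    rewrite /D /=; case: eqVneq => [->//|_]; case: eqVneq => [->//|_//].
  by split; [have := Dw i I|have := Dw j I]; rewrite /= ?Di ?Dj.
rewrite ind; last by move=> k; rewrite /D; case: ifP => // _; case: ifP.
have rest1 : (\prod_(k < n | (k != i) && (k != j)) P (X k @^-1` D k) = 1)%E.
  apply: big1 => k /andP[ki kj].
  by rewrite /D (negbTE ki) (negbTE kj) preimage_setT probability_setT.
have ji : j != i by rewrite eq_sym.
rewrite (bigD1 i)//= (bigD1 j)//= rest1 mule1 Di Dj.
by rewrite -(dist i A)// -(dist j B).
Qed.

Lemma Rintegral_law (i : 'I_n) (u : R -> R) (C : R) :
  measurable_fun setT u -> (forall x, `|u x| <= C) ->
  \int[P]_w u (X i w) = \int[nu]_x u x.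
Proof.
move=> mu uC; have [_ dist] := iidX; rewrite /Rintegral; congr fine.
rewrite -(@integral_distribution _ _ _ _ _ _ (X i) (EFin \o u)).
- by apply: eq_measure_integral => A mA _; exact: dist.
- exact/measurable_EFinP.
- apply: (@bounded_integrable _ _ _ _ (u \o X i) C); first exact: measurableT_comp.
  by move=> w; exact: uC.
Qed.

(** The joint law of [X i] and [X j] agrees with the product of [nu] with itself on rectangles,
    hence everywhere, and Fubini splits the integral. *)
Lemma Rintegral_pair (i j : 'I_n) (f g : R -> R) (C : R) : i != j ->
  measurable_fun setT f -> (forall x, `|f x| <= C) ->
  measurable_fun setT g -> (forall x, `|g x| <= C) ->
  \int[P]_w (f (X i w) * g (X j w)) = (\int[nu]_x f x) * (\int[nu]_x g x).
Proof.
move=> ij mf fC mg gC.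
have mZ : measurable_fun setT (fun w => (X i w, X j w)).
  exact: measurable_fun_pair.
pose Z : {mfun T >-> (R * R)%type} :=
  HB.pack (fun w => (X i w, X j w)) (isMeasurableFun.Build _ _ _ _ _ mZ).
pose h (z : R * R) := f z.1 * g z.2.
have mh : measurable_fun setT h.
  by apply: measurable_funM; apply: measurableT_comp.
have hC z : `|h z| <= C * C by rewrite normrM ler_pM.
have prodE S : measurable S -> (nu \x nu)%E S = distribution P Z S.
  move=> mS; apply: product_measure_unique => // A B mA mB.
  by rewrite -(pair_law ij).
have ih : (nu \x nu)%E.-integrable setT (EFin \o h).
  apply: (@bounded_integrable _ _ _ (nu \x nu)%E h (C * C)) => //.
rewrite /Rintegral.
have -> : (\int[P]_w (f (X i w) * g (X j w))%:E =
           \int[nu]_x \int[nu]_y (EFin \o h) (x, y))%E.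
  rewrite integral12_prod_meas1//.
  transitivity (\int[distribution P Z]_z (h z)%:E)%E; last first.
    by apply: eq_measure_integral => A mA _; exact/esym/prodE.
  rewrite (@integral_distribution _ _ _ _ _ _ Z (EFin \o h))//.
    exact/measurable_EFinP.
  apply: (@bounded_integrable _ _ _ _ (h \o Z) (C * C)); first exact: measurableT_comp.
  by move=> w; exact: hC.
have fi := bounded_integrable nu mf fC.
have gi := bounded_integrable nu mg gC.
have gfin := integrable_fin_num measurableT gi.
have ffin := integrable_fin_num measurableT fi.
transitivity (fine (\int[nu]_x ((\int[nu]_y (g y)%:E) * (f x)%:E))%E).
  congr fine; apply: eq_integral => x _; rewrite muleC -integralZl//.
rewrite -[X in (\int[nu]_x (X * _))%E](fineK gfin) integralZl//.
by rewrite (fineK gfin) muleC fineM.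
Qed.

(** The square is expanded over pairs of indices. Centred terms at distinct indices are
    uncorrelated, so only the [n] diagonal terms survive, each equal to the variance of [u], which
    is at most its second moment. *)
Lemma sample_mean_sqr (u : R -> R) (C : R) : (0 < n)%N ->
  measurable_fun setT u -> (forall x, `|u x| <= C) ->
  (\int[P]_w ((n%:R^-1 * \sum_(j < n) u (X j w) - \int[nu]_x u x) ^+ 2)%:E <=
   (n%:R^-1 * \int[nu]_x (u x ^+ 2))%:E)%E.
Proof.
move=> n0 mu uC; set m := Rintegral nu setT u.
have nn0 : n%:R != 0 :> R by rewrite pnatr_eq0 -lt0n.
pose v x := u x - m; pose D := C + `|m|.
have mv : measurable_fun setT v by exact: measurable_funB.
have vD x : `|v x| <= D by rewrite (le_trans (ler_normB _ _))// lerD2r.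
have D0 : 0 <= D by exact: le_trans (vD 0).
have ui := bounded_integrable nu mu uC.
have ci k := finite_measure_integrable_cst nu k measurableT.
have v0 : \int[nu]_x v x = 0.
  by rewrite (RintegralB measurableT ui (ci m)) Rintegral_cst_probability subrr.
have v2 : \int[nu]_x (v x * v x) <= \int[nu]_x (u x ^+ 2).
  rewrite -[leLHS]/(\int[nu]_x ((u x - m) ^+ 2)) (Rintegral_sqr_sub_mean nu mu uC).
  by rewrite gerBl sqr_ge0.
have E w : (n%:R^-1 * \sum_(j < n) u (X j w) - m) ^+ 2 =
    n%:R^-2 * \sum_(p : 'I_n * 'I_n) v (X p.1 w) * v (X p.2 w).
  have -> : n%:R^-1 * \sum_(j < n) u (X j w) - m = n%:R^-1 * \sum_(j < n) v (X j w).
    rewrite /v sumrB sumr_const card_ord mulrBr -[m *+ n]mulr_natl mulrA mulVf//.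
    by rewrite mul1r.
  rewrite exprMn exprVn; congr (_ * _).
  by rewrite expr2 big_distrlr/= pair_bigA.
have vvi (p : 'I_n * 'I_n) :
    P.-integrable setT (EFin \o (fun w => v (X p.1 w) * v (X p.2 w))).
  apply: (@bounded_integrable _ _ _ _ _ (D * D)).
    by apply: measurable_funM; exact: measurableT_comp.
  by move=> w; rewrite normrM ler_pM.
have si : P.-integrable setT
    (EFin \o (fun w => \sum_(p : 'I_n * 'I_n) v (X p.1 w) * v (X p.2 w))).
  rewrite (_ : EFin \o _ = (fun w => \sum_(p : 'I_n * 'I_n) (v (X p.1 w) * v (X p.2 w))%:E)%E).
    by apply: integrable_sum => // p _; exact: vvi.
  by apply/funext => w /=; rewrite sumEFin.
under eq_integral do rewrite E EFinM.
rewrite integralZl// -[X in (_ * X)%E]fineK ?integrable_fin_num//.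
rewrite -EFinM lee_fin -/(Rintegral P setT _) Rintegral_sum//.
rewrite -(pair_bigA _ (fun i j => \int[P]_w (v (X i w) * v (X j w))))/=.
have sumE i : \sum_(j < n) \int[P]_w (v (X i w) * v (X j w)) = \int[nu]_x (v x * v x).
  rewrite (bigD1 i)//= big1 ?addr0.
    rewrite (@Rintegral_law i (fun x => v x * v x) (D * D))//.
      exact: measurable_funM.
    by move=> x; rewrite normrM ler_pM.
  move=> j ji; rewrite (@Rintegral_pair i j v v D)// ?v0 ?mul0r//.
  by rewrite eq_sym.
under eq_bigr do rewrite sumE.
rewrite sumr_const card_ord -[(Rintegral _ _ _) *+ n]mulr_natl mulrA.
have -> : n%:R^-2 * n%:R = n%:R^-1 :> R by field.
by rewrite ler_wpM2l.
Qed.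

End SampleMean.

(** * Real and imaginary parts of characteristic functions *)

Section ComplexParts.
Local Open Scope complex_scope.

Lemma cexp_imag (R : realType) (x : R) : cexp (x *i) = cos x +i* sin x.
Proof. by rewrite /cexp /= expR0 rmorph1 mul1r. Qed.

Lemma Re_sum (R : rcfType) (I : Type) (s : seq I) (F : I -> R[i]) :
  complex.Re (\sum_(i <- s) F i) = \sum_(i <- s) complex.Re (F i).
Proof.
elim: s => [|i s IH]; first by rewrite !big_nil.
by rewrite !big_cons -IH; case: (F i) => a b; case: (\sum_(_ <- _) _).
Qed.

Lemma Im_sum (R : rcfType) (I : Type) (s : seq I) (F : I -> R[i]) :
  complex.Im (\sum_(i <- s) F i) = \sum_(i <- s) complex.Im (F i).
Proof.
elim: s => [|i s IH]; first by rewrite !big_nil.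
by rewrite !big_cons -IH; case: (F i) => a b; case: (\sum_(_ <- _) _).
Qed.

Lemma Re_real_mul (R : rcfType) (a : R) (z : R[i]) :
  complex.Re (a%:C * z) = a * complex.Re z.
Proof. by case: z => x y /=; rewrite mul0r subr0. Qed.

Lemma Im_real_mul (R : rcfType) (a : R) (z : R[i]) :
  complex.Im (a%:C * z) = a * complex.Im z.
Proof. by case: z => x y /=; rewrite mul0r addr0. Qed.

Lemma natV_complex (R : rcfType) n : (n%:R^-1 : R[i]) = (n%:R^-1)%:C.
Proof. by rewrite fmorphV rmorph_nat. Qed.

Section CharfunParts.
Variable R : realType.
Implicit Types t : R.

Lemma Re_charfun (nu : probability R R) t :
  complex.Re (charfun nu t) = \int[nu]_x cos (t * x).
Proof. by apply: eq_Rintegral => x _; rewrite cexp_imag. Qed.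

Lemma Im_charfun (nu : probability R R) t :
  complex.Im (charfun nu t) = \int[nu]_x sin (t * x).
Proof. by apply: eq_Rintegral => x _; rewrite cexp_imag. Qed.

Lemma Re_empirical n (x : 'I_n -> R) t :
  complex.Re (empirical_charfun x t) = n%:R^-1 * \sum_(j < n) cos (t * x j).
Proof.
rewrite /empirical_charfun natV_complex Re_real_mul Re_sum.
by congr (_ * _); apply: eq_bigr => j _; rewrite cexp_imag.
Qed.

Lemma Im_empirical n (x : 'I_n -> R) t :
  complex.Im (empirical_charfun x t) = n%:R^-1 * \sum_(j < n) sin (t * x j).
Proof.
rewrite /empirical_charfun natV_complex Im_real_mul Im_sum.
by congr (_ * _); apply: eq_bigr => j _; rewrite cexp_imag.
Qed.

End CharfunParts.

(** Lebesgue measure is invariant under reflection. This is what makes the sine part of the Levy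
    integral vanish for an even density. *)
Lemma Rintegral_opp (R : realType) (f : R -> R) :
  (@lebesgue_measure R).-integrable setT (EFin \o f) ->
  (@lebesgue_measure R).-integrable setT (EFin \o (fun x => f (- x))) ->
  \int[@lebesgue_measure R]_x f (- x) = \int[@lebesgue_measure R]_x f x.
Proof.
move=> fi fNi; rewrite /Rintegral; congr fine.
have mN : measurable_fun [set: measurableTypeR R] (-%R : _ -> measurableTypeR R).
  exact: measurable_funN.
have := @integral_pushforward _ _ _ _ R _ mN lebesgue_measure setT (EFin \o f)
   (measurable_int _ fi) fNi measurableT.
move=> /= <-.
by apply: eq_measure_integral => A mA _; exact: lebesgue_measureN.
Qed.

End ComplexParts.

(** * Characteristic functions of symmetric compound Poisson laws with drift *)

Section SymmetricLevy.
Local Open Scope complex_scope.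

Section LevySymmetric.
Variable R : realType.
Local Notation mu := (@lebesgue_measure R).

Lemma measurable_cos_mul (t : R) : measurable_fun setT (fun x : R => cos (t * x)).
Proof.
apply: continuous_measurable_fun => x; apply: continuous_comp.
  exact: mulrl_continuous.
exact: continuous_cos.
Qed.

Lemma measurable_sin_mul (t : R) : measurable_fun setT (fun x : R => sin (t * x)).
Proof.
apply: continuous_measurable_fun => x; apply: continuous_comp.
  exact: mulrl_continuous.
exact: continuous_sin.
Qed.

Lemma bounded_mul_integrable (g rho : R -> R) (C : R) :
  measurable_fun setT g -> (forall x, `|g x| <= C) ->
  mu.-integrable setT (EFin \o rho) ->
  mu.-integrable setT (EFin \o (fun x : R => g x * rho x)).
Proof.
move=> mg gC ri; have mg' : measurable_fun [set: measurableTypeR R] g := mg.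
have bg : [bounded g x | x in [set: measurableTypeR R]].
  exists C; split; first exact: num_real.
  by move=> M CM x _; apply: le_trans (gC x) (ltW CM).
exact: (integrableMr measurableT mg' bg ri).
Qed.

Lemma integrable_scale (k : R) (g : R -> R) :
  mu.-integrable setT (EFin \o g) ->
  mu.-integrable setT (EFin \o (fun x : R => k * g x)).
Proof. by move=> gi; have := integrableZl measurableT k gi. Qed.

(** The sine integral vanishes by oddness, so the phase is exactly [gamma * t] and the modulus is
    [a t = expR (- sigma^2 t^2 / 2 - J t)], where [J t] integrates [1 - cos (t * x)] against [rho].
    The lower bound on [a] uses [J t <= 2 * Lambda]; the bound on [1 - a t] uses
    [J t <= Lambda * K * t^2 / 2], which comes from the second moment. *)
Lemma levy_charfun_symmetric (gamma sigma Lambda K beta L : R) (rho : R -> R) :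
  W_sym beta L Lambda K rho ->
  exists a : R -> R, forall t,
    [/\ levy_charfun gamma sigma rho t =
          a t * cos (gamma * t) +i* (a t * sin (gamma * t)),
        expR (- (sigma ^+ 2 * t ^+ 2 / 2 + 2 * Lambda)) <= a t,
        a t <= 1 &
        1 - a t <= (sigma ^+ 2 + Lambda * K) * t ^+ 2 / 2].
Proof.
move=> [[lam [f [rhoE [mf f0 f1] x2f _ /andP[lam0 lamL]]]] rho_even].
have fi : mu.-integrable setT (EFin \o f).
  apply/integrableP; split; first exact/measurable_EFinP.
  rewrite (_ : (\int[_]_(x in _) _)%E = 1%E) ?ltry// -f1.
  by apply: eq_integral => x _ /=; rewrite ger0_norm.
have ri : mu.-integrable setT (EFin \o rho) by rewrite rhoE; exact: integrable_scale.
have mx2f : measurable_fun setT (fun x : R => x ^+ 2 * f x).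
  by apply: measurable_funM => //; exact: measurable_funX.
have mx2f' : measurable_fun [set: measurableTypeR R] (fun x : R => x ^+ 2 * f x) := mx2f.
have x2i : mu.-integrable setT (EFin \o (fun x : R => x ^+ 2 * f x)).
  apply/integrableP; split; first exact/measurable_EFinP.
  apply: (@le_lt_trans _ _ K%:E); last exact: ltry.
  apply: le_trans x2f; rewrite le_eqVlt; apply/orP; left; apply/eqP.
  by apply: eq_integral => x _ /=; rewrite ger0_norm// mulr_ge0// sqr_ge0.
have K2 : \int[mu]_x (x ^+ 2 * f x) <= K.
  rewrite -lee_fin /Rintegral fineK//; exact: (integrable_fin_num measurableT x2i).
have rf1 : \int[mu]_x f x = 1 by rewrite /Rintegral f1.
have ci t : mu.-integrable setT (EFin \o (fun x : R => (1 - cos (t * x)) * rho x)).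
  apply: (@bounded_mul_integrable _ _ 2) => //.
    by apply: measurable_funB => //; exact: measurable_cos_mul.
  by move=> x; have := cos_le1 (t * x); have := cos_geN1 (t * x); rewrite ler_norml; lra.
have si t : mu.-integrable setT (EFin \o (fun x : R => sin (t * x) * rho x)).
  apply: (@bounded_mul_integrable _ _ 1) => //; first exact: measurable_sin_mul.
  by move=> x; exact: sin_max.
pose J t := \int[mu]_x ((1 - cos (t * x)) * rho x).
have rho0 x : 0 <= rho x by rewrite rhoE mulr_ge0// ltW.
have J2 t : J t <= 2 * Lambda.
  apply: (@le_trans _ _ (\int[mu]_x (2 * lam * f x))).
    apply: le_Rintegral => //; first exact: integrable_scale.
    move=> x _; rewrite rhoE mulrA ler_wpM2r// ler_wpM2r//; first exact: ltW.
    by have := cos_geN1 (t * x); lra.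
  by rewrite RintegralZl// rf1; lra.
have JK t : J t <= Lambda * K * t ^+ 2 / 2.
  apply: (@le_trans _ _ (\int[mu]_x (lam * t ^+ 2 / 2 * (x ^+ 2 * f x)))).
    apply: le_Rintegral => //; first exact: integrable_scale.
    move=> x _; rewrite rhoE; have := one_sub_cos_le (t * x).
    rewrite (_ : lam * t ^+ 2 / 2 * (x ^+ 2 * f x) = (t * x) ^+ 2 / 2 * (lam * f x)); last by field.
    by move=> h; rewrite ler_wpM2r// mulr_ge0// ltW.
  rewrite RintegralZl//.
  have K0 : 0 <= \int[mu]_x (x ^+ 2 * f x).
    by apply: Rintegral_ge0 => x _; rewrite mulr_ge0// sqr_ge0.
  have := sqr_ge0 t; set I := Rintegral _ _ _ in K2 K0 *; set t2 := t ^+ 2 => t20.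
  have : lam * I <= Lambda * K by rewrite ler_pM// ltW.
  by move=> /(ler_wpM2r t20); lra.
have J0 t : 0 <= J t.
  by apply: Rintegral_ge0 => x _; rewrite mulr_ge0// subr_ge0 cos_le1.
have S0 t : \int[mu]_x (sin (t * x) * rho x) = 0.
  set g := fun x => sin (t * x) * rho x.
  have gi : mu.-integrable setT (EFin \o g) := si t.
  have gN : (fun x => g (- x)) = (fun x => (-1) * g x).
    by apply/funext => x; rewrite /g rho_even mulrN sinN !mulNr mul1r.
  have := @Rintegral_opp R g (si t).
  rewrite gN => /(_ (integrable_scale (-1) (si t))).
  by rewrite RintegralZl// mulN1r => /eqP; rewrite eq_sym -addr_eq0 -mulr2n mulrn_eq0 => /eqP.
exists (fun t => expR (- (sigma ^+ 2 * t ^+ 2 / 2) - J t)) => t; split.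
- rewrite /levy_charfun; set I := Cintegral _ _ _.
  have -> : I = (- J t)%:C.
    rewrite /I /Cintegral.
    set I1 := Rintegral _ _ _; have -> : I1 = - J t.
      rewrite -[RHS]mulN1r -(RintegralZl _ measurableT (ci t)) /I1; apply: eq_Rintegral => x _.
      by rewrite cexp_imag /=; ring.
    congr (_ +i* _); rewrite -[RHS](S0 t).
    by apply: eq_Rintegral => x _; rewrite cexp_imag /=; ring.
  rewrite /cexp; set z := (X in complex.Re X).
  have -> : complex.Re z = - (sigma ^+ 2 * t ^+ 2 / 2) - J t by rewrite /z /=; ring.
  have -> : complex.Im z = gamma * t by rewrite /z /=; ring.
  by set e := expR _; rewrite -[LHS]/(_ +i* _)/= !mul0r subr0 addr0.
- rewrite ler_expR; have := J2 t; lra.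
- rewrite -[leRHS]expR0 ler_expR; have := J0 t; have := mulr_ge0 (sqr_ge0 sigma) (sqr_ge0 t); lra.
- have := expR_ge1Dx (- (sigma ^+ 2 * t ^+ 2 / 2) - J t); have := JK t; lra.
Qed.

End LevySymmetric.

End SymmetricLevy.

(** * Continuity criteria *)

Lemma continuous_of_sqr_dist_le (R : realType) (f : R -> R) (V : R) : 0 <= V ->
  (forall s t, (f t - f s) ^+ 2 <= V * (t - s) ^+ 2) -> continuous f.
Proof.
move=> V0 fV x; apply/cvgrPdist_le => e e0.
(* Adding 1 to the Lipschitz constant keeps the divisor positive when [V = 0]. *)
have c0 : 0 < Num.sqrt V + 1 by rewrite ltr_wpDl// sqrtr_ge0.
have lip y : `|f x - f y| <= Num.sqrt V * `|x - y|.
  rewrite -sqrtr_sqr -[X in _ * X]sqrtr_sqr -sqrtrM// ler_wsqrtr//.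
have /cvgrPdist_le/(_ (e / (Num.sqrt V + 1))) : y @[y --> x] --> x by exact: cvg_id.
move=> /(_ (divr_gt0 e0 c0)); apply: filterS => y xy.
apply: (le_trans (lip y)); rewrite (@le_trans _ _ ((Num.sqrt V + 1) * `|x - y|))//.
  by rewrite ler_wpM2r// lerDl.
by rewrite mulrC -ler_pdivlMr.
Qed.

Lemma continuous_mean_comp (R : realType) n (phi : R -> R) (x : 'I_n -> R) :
  continuous phi -> continuous (fun t : R => n%:R^-1 * \sum_(j < n) phi (t * x j)).
Proof.
move=> cphi t; apply: cvgM; first exact: cvg_cst.
apply: cvg_big => //; first exact: add_continuous.
move=> j _; apply: continuous_cvg; first exact: cphi.
by apply: cvgM; [exact: cvg_id|exact: cvg_cst].
Qed.

(** * Deviation of the empirical characteristic function *)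

Section EmpiricalDeviation.
Context (R : realType) (nu : probability R R) (V : R).
Hypothesis nuV : forall u : R, 1 - \int[nu]_x cos (u * x) <= V * u ^+ 2 / 2.

(** For [phi] equal to [cos] or [sin] this is the real or the imaginary part of g = phi_emp - phi_X
    at [t]. *)
Definition dev n (phi : R -> R) (x : 'I_n -> R) (t : R) : R :=
  n%:R^-1 * \sum_(j < n) phi (t * x j) - \int[nu]_y phi (t * y).

(** This is |g t - g s|^2. *)
Definition dev_dist2 n (x : 'I_n -> R) (s t : R) : R :=
  (dev cos x t - dev cos x s) ^+ 2 + (dev sin x t - dev sin x s) ^+ 2.

(* The expected sum over level k is O (2^-k), so any weight growing slower than
   2^k keeps the series convergent; 25 / 16 = (5 / 4)^2 makes the square roots
   of the inverse weights the geometric sequence required by [chaining]. *)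
Definition chain_sum r n (x : 'I_n -> R) : \bar R :=
  (\sum_(k <oo) ((25 / 16) ^+ k * \sum_(i < 2 ^ k)
     dev_dist2 x (r * dyadic R k i) (r * dyadic R k i.+1))%:E)%E.

Lemma increment_const_ge0 : 0 <= V.
Proof.
have := nuV 1.
have : \int[nu]_x cos (1 * x) <= 1.
  rewrite -[leRHS](Rintegral_cst_probability nu 1).
  have ci : nu.-integrable setT (EFin \o (fun x : R => cos (1 * x))).
    by apply: (bounded_integrable nu (measurable_cos_mul 1) (C := 1)) => x; exact: cos_max.
  have oi := finite_measure_integrable_cst nu 1 measurableT.
  by apply: (le_Rintegral measurableT ci oi) => x _; exact: cos_le1.
by lra.
Qed.

Lemma norm_cos_sub_le2 s t (x : R) : `|cos (t * x) - cos (s * x)| <= 2.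
Proof.
by rewrite (le_trans (ler_normB _ _))//; have := cos_max (t * x); have := cos_max (s * x); lra.
Qed.

Lemma norm_sin_sub_le2 s t (x : R) : `|sin (t * x) - sin (s * x)| <= 2.
Proof.
by rewrite (le_trans (ler_normB _ _))//; have := sin_max (t * x); have := sin_max (s * x); lra.
Qed.

Lemma measurable_cos_sub s t : measurable_fun setT (fun x : R => cos (t * x) - cos (s * x)).
Proof. by apply: measurable_funB; exact: measurable_cos_mul. Qed.

Lemma measurable_sin_sub s t : measurable_fun setT (fun x : R => sin (t * x) - sin (s * x)).
Proof. by apply: measurable_funB; exact: measurable_sin_mul. Qed.

Lemma cos_integrable t : nu.-integrable setT (EFin \o (fun x : R => cos (t * x))).
Proof. apply: (bounded_integrable nu (measurable_cos_mul t) (C := 1)) => x; exact: cos_max. Qed.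

Lemma sin_integrable t : nu.-integrable setT (EFin \o (fun x : R => sin (t * x))).
Proof. apply: (bounded_integrable nu (measurable_sin_mul t) (C := 1)) => x; exact: sin_max. Qed.

(** The integrands add up to |e^(itx) - e^(isx)|^2 = 2 (1 - cos ((t - s) x)), whose mean [nuV]
    bounds. *)
Lemma second_moment_increment s t :
  \int[nu]_x ((cos (t * x) - cos (s * x)) ^+ 2) +
  \int[nu]_x ((sin (t * x) - sin (s * x)) ^+ 2) <= V * (t - s) ^+ 2.
Proof.
have bnd2 (u : R -> R) : (forall x, `|u x| <= 2) -> forall x, `|u x ^+ 2| <= 4.
  by move=> u2 x; rewrite normrX (le_trans (lerXn2r 2 _ _ (u2 x))) ?nnegrE//; lra.
have ci := bounded_integrable nu (measurable_funX 2 (measurable_cos_sub s t)) (bnd2 _ (norm_cos_sub_le2 s t)).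
have si := bounded_integrable nu (measurable_funX 2 (measurable_sin_sub s t)) (bnd2 _ (norm_sin_sub_le2 s t)).
rewrite -RintegralD//.
under eq_Rintegral do rewrite sqr_dist_cos_sin -mulrBl.
have oi := finite_measure_integrable_cst nu 1 measurableT.
have di := integrableB measurableT oi (cos_integrable (t - s)).
rewrite (RintegralZl _ measurableT di).
rewrite (RintegralB measurableT oi (cos_integrable (t - s))) Rintegral_cst_probability.
by have := nuV (t - s); lra.
Qed.

Lemma measurable_dev n d (T : measurableType d) (P : probability T R)
    (X : 'I_n -> {RV P >-> R}) (phi : R -> R) :
  (forall u, measurable_fun setT (fun x : R => phi (u * x))) ->
  forall u, measurable_fun setT (fun w => dev phi (fun j => X j w) u).
Proof.
move=> mphi u; apply: measurable_funB => //; apply: measurable_funM => //.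
by apply: measurable_sum => j; apply: (measurableT_comp (mphi u)).
Qed.

Lemma measurable_dev_dist2 n d (T : measurableType d) (P : probability T R)
    (X : 'I_n -> {RV P >-> R}) s t :
  measurable_fun setT (fun w => dev_dist2 (fun j => X j w) s t).
Proof.
have mc := measurable_dev X (@measurable_cos_mul R).
have ms := measurable_dev X (@measurable_sin_mul R).
by apply: measurable_funD; apply: measurable_funX; apply: measurable_funB.
Qed.

Lemma dev_dist2_ge0 n (x : 'I_n -> R) s t : 0 <= dev_dist2 x s t.
Proof. by rewrite addr_ge0// sqr_ge0. Qed.

(** An increment of the deviation is again a centred sample mean, that of
    [phi (t * x) - phi (s * x)], so averaging over the sample gains the factor 1/n. *)
Lemma dev_dist2_mean n d (T : measurableType d) (P : probability T R)
    (X : 'I_n -> {RV P >-> R}) s t : (0 < n)%N -> iid_sample nu X ->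
  (\int[P]_w (dev_dist2 (fun j => X j w) s t)%:E <= (V * (t - s) ^+ 2 / n%:R)%:E)%E.
Proof.
move=> n0 iidX.
have devB (phi : R -> R) : (forall u, nu.-integrable setT (EFin \o (fun x : R => phi (u * x)))) ->
    forall x : 'I_n -> R,
    dev phi x t - dev phi x s = n%:R^-1 * \sum_(j < n) (phi (t * x j) - phi (s * x j))
      - \int[nu]_y (phi (t * y) - phi (s * y)).
  by move=> phii x; rewrite RintegralB// sumrB mulrBr /dev; ring.
have mc := measurable_dev X (@measurable_cos_mul R).
have ms := measurable_dev X (@measurable_sin_mul R).
under eq_integral do rewrite EFinD.
have mq (phi : R -> R) : (forall u, measurable_fun setT (fun w => dev phi (fun j => X j w) u)) ->
    measurable_fun setT (fun w => ((dev phi (fun j => X j w) t - dev phi (fun j => X j w) s) ^+ 2)%:E).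
  by move=> mphi; apply/measurable_EFinP; apply: measurable_funX; apply: measurable_funB.
have q0 (phi : R -> R) w : [set: T] w ->
    (0 <= ((dev phi (fun j => X j w) t - dev phi (fun j => X j w) s) ^+ 2)%:E)%E.
  by rewrite lee_fin sqr_ge0.
rewrite (ge0_integralD P measurableT (q0 cos) (mq _ mc) (q0 sin) (mq _ ms)).
under eq_integral do rewrite (devB _ cos_integrable).
under [X in (_ + X)%E]eq_integral do rewrite (devB _ sin_integrable).
have hc := sample_mean_sqr iidX n0 (measurable_cos_sub s t) (norm_cos_sub_le2 s t).
have hs := sample_mean_sqr iidX n0 (measurable_sin_sub s t) (norm_sin_sub_le2 s t).
apply: (le_trans (leeD hc hs)); rewrite -EFinD lee_fin -mulrDr mulrC ler_wpM2r//.
exact: second_moment_increment.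
Qed.

Lemma chain_sum_term_ge0 r n (x : 'I_n -> R) k :
  0 <= (25 / 16) ^+ k * \sum_(i < 2 ^ k)
     dev_dist2 x (r * dyadic R k i) (r * dyadic R k i.+1).
Proof.
have c0 : 0 <= 25 / 16 :> R by lra.
by rewrite mulr_ge0 ?exprn_ge0// sumr_ge0// => i _; exact: dev_dist2_ge0.
Qed.

Lemma chain_sum_ge0 r n (x : 'I_n -> R) : (0 <= chain_sum r x)%E.
Proof. by apply: nneseries_ge0 => k _ _; rewrite lee_fin chain_sum_term_ge0. Qed.

Lemma measurable_chain_sum r n d (T : measurableType d) (P : probability T R)
    (X : 'I_n -> {RV P >-> R}) :
  measurable_fun setT (fun w => chain_sum r (fun j => X j w)).
Proof.
apply: ge0_emeasurable_sum => k.
- by move=> w _ _; rewrite lee_fin chain_sum_term_ge0.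
- move=> _; apply/measurable_EFinP; apply: measurable_funM => //.
  by apply: measurable_sum => i; exact: measurable_dev_dist2.
Qed.

(** Level [k] has 2^k increments, each over a step of length r / 2^k. With the weight (25/16)^k its
    mean is at most C (25/32)^k for C = V r^2 / n, and the geometric series 32/7 is below 5. *)
Lemma chain_sum_mean r n d (T : measurableType d) (P : probability T R)
    (X : 'I_n -> {RV P >-> R}) : (0 < n)%N -> iid_sample nu X ->
  (\int[P]_w chain_sum r (fun j => X j w) <= (5 * V * r ^+ 2 / n%:R)%:E)%E.
Proof.
move=> n0 iidX; pose D k (i : 'I_(2 ^ k)) w :=
  dev_dist2 (fun j => X j w) (r * dyadic R k i) (r * dyadic R k i.+1).
have D0 k i w : 0 <= D k i w by exact: dev_dist2_ge0.
have mD k i : measurable_fun setT (@D k i) by exact: measurable_dev_dist2.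
have c0 k : 0 <= (25 / 16 : R) ^+ k by rewrite exprn_ge0//; lra.
have S0 k w : 0 <= (25 / 16) ^+ k * \sum_(i < 2 ^ k) D k i w.
  by rewrite mulr_ge0// sumr_ge0.
rewrite /chain_sum integral_nneseries//; first last.
- by move=> k w _; rewrite lee_fin; exact: S0.
- move=> k; apply/measurable_EFinP; apply: measurable_funM => //.
  by apply: measurable_sum => i; exact: mD.
set C := V * r ^+ 2 / n%:R.
have V0 := increment_const_ge0.
have C0 : 0 <= C by rewrite /C divr_ge0// mulr_ge0// sqr_ge0.
have term k : (\int[P]_w ((25 / 16) ^+ k * \sum_(i < 2 ^ k) D k i w)%:E <=
    (C * (25 / 32) ^+ k)%:E)%E.
  under eq_integral do rewrite EFinM -sumEFin.
  rewrite ge0_integralZl_EFin//; first last.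
  - by apply: emeasurable_sum => i; apply/measurable_EFinP; exact: mD.
  - by move=> w _; apply: sume_ge0 => i _; rewrite lee_fin.
  rewrite ge0_integral_sum//; first last.
  - by move=> i w _; rewrite lee_fin.
  - by move=> i; apply/measurable_EFinP; exact: mD.
  apply: (@le_trans _ _ (((25 / 16) ^+ k)%:E * \sum_(i < 2 ^ k) (C / 4 ^+ k)%:E)%E).
    rewrite lee_wpmul2l ?lee_fin//; apply: lee_sum => i _.
    apply: (le_trans (dev_dist2_mean _ _ n0 iidX)); rewrite lee_fin le_eqVlt.
    apply/orP; left; apply/eqP.
    rewrite -mulrBr /dyadic -mulrBl -natr1 addrAC subrr add0r mul1r exprMn.
    rewrite -exprVn -exprM mulnC exprM /C.
    have -> : (2^-1 : R) ^+ 2 = 4^-1 by field.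
    by rewrite exprVn; ring.
  rewrite sumEFin sumr_const card_ord -EFinM lee_fin.
  rewrite -[(C / 4 ^+ k) *+ _]mulr_natl natrX.
  have -> : (25 / 32 : R) = (25 / 16) * (2 / 4) by field.
  rewrite [in leRHS]exprMn [(2 / 4) ^+ k]expr_div_n le_eqVlt.
  by apply/orP; left; apply/eqP; ring.
apply: (@le_trans _ _ (\sum_(k <oo) (C * (25 / 32) ^+ k)%:E)%E).
  by apply: lee_nneseries => // k _ _; apply: integral_ge0 => w _; rewrite lee_fin; exact: S0.
have q0 k : 0 <= (25 / 32 : R) ^+ k by rewrite exprn_ge0//; lra.
apply: lime_le.
  by apply: is_cvg_nneseries => k _ _; rewrite lee_fin mulr_ge0.
apply: nearW => N; rewrite sumEFin lee_fin big_mkord -mulr_sumr.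
rewrite (_ : 5 * V * r ^+ 2 / n%:R = C * 5); last by rewrite /C; ring.
rewrite ler_wpM2l//.
have := subrX1 (25 / 32 : R) N; have := q0 N; lra.
Qed.

Lemma continuous_dev n (phi : R -> R) (x : 'I_n -> R) : continuous phi ->
  continuous (fun t : R => \int[nu]_y phi (t * y)) -> continuous (dev phi x).
Proof.
move=> cphi cint t.
by apply: cvgB; [exact: (continuous_mean_comp cphi)|exact: cint].
Qed.

(** The square of a mean increment is at most its mean square, so both parts are Lipschitz. *)
Lemma continuous_charfun_parts :
  continuous (fun t : R => \int[nu]_y cos (t * y)) /\
  continuous (fun t : R => \int[nu]_y sin (t * y)).
Proof.
split; apply: (continuous_of_sqr_dist_le increment_const_ge0) => s t.
- rewrite -(RintegralB measurableT (cos_integrable t) (cos_integrable s)).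
  apply: (le_trans (sqr_Rintegral_le nu (measurable_cos_sub s t) (norm_cos_sub_le2 s t))).
  apply: le_trans (second_moment_increment s t); rewrite lerDl.
  by apply: Rintegral_ge0 => x _; exact: sqr_ge0.
- rewrite -(RintegralB measurableT (sin_integrable t) (sin_integrable s)).
  apply: (le_trans (sqr_Rintegral_le nu (measurable_sin_sub s t) (norm_sin_sub_le2 s t))).
  apply: le_trans (second_moment_increment s t); rewrite lerDr.
  by apply: Rintegral_ge0 => x _; exact: sqr_ge0.
Qed.

(** No weighted level exceeds the whole series, hence every increment of level [k] is at most
    [s * (4 / 5) ^+ k]. Chaining, rescaled to [0, r], handles [t >= 0]; negative [t] follow since
    [cos] is even and [sin] odd. *)
Lemma chain_sum_sup r n (x : 'I_n -> R) (s : R) : (0 < n)%N -> 0 < r -> 0 <= s ->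
  (chain_sum r x <= (s ^+ 2)%:E)%E ->
  forall t, `|t| <= r -> `|dev cos x t| <= 5 * s /\ `|dev sin x t| <= 5 * s.
Proof.
move=> n0 r0 s0 Ss.
have nn0 : n%:R != 0 :> R by rewrite pnatr_eq0 -lt0n.
have p0 k : 0 < (25 / 16 : R) ^+ k by rewrite exprn_gt0//; lra.
have term k (i : 'I_(2 ^ k)) :
    dev_dist2 x (r * dyadic R k i) (r * dyadic R k i.+1) <= (s * (4 / 5) ^+ k) ^+ 2.
  have S0 j : (0 <= ((25 / 16) ^+ j * \sum_(i < 2 ^ j)
     dev_dist2 x (r * dyadic R j i) (r * dyadic R j i.+1))%:E)%E.
    by rewrite lee_fin mulr_ge0 ?(ltW (p0 j))// sumr_ge0// => l _; exact: dev_dist2_ge0.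
  have h : (((25 / 16) ^+ k * \sum_(i < 2 ^ k)
     dev_dist2 x (r * dyadic R k i) (r * dyadic R k i.+1))%:E <= (s ^+ 2)%:E)%E.
    apply: le_trans Ss; rewrite /chain_sum.
    apply: le_trans (nneseries_lim_ge k.+1 (fun j _ _ => S0 j)).
    rewrite big_nat_recr//= leeDr//.
    by apply: sume_ge0 => j _; exact: S0.
  rewrite lee_fin in h.
  have -> : (s * (4 / 5) ^+ k) ^+ 2 = s ^+ 2 / (25 / 16) ^+ k.
    rewrite exprMn -exprM mulnC exprM; congr (_ * _).
    by rewrite -exprVn; congr (_ ^+ _); field.
  rewrite ler_pdivlMr// mulrC; apply: le_trans h; rewrite ler_pM2l//.
  by rewrite (bigD1 i)//= lerDl sumr_ge0// => l _; exact: dev_dist2_ge0.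
have sk0 k : 0 <= s * (4 / 5 : R) ^+ k by rewrite mulr_ge0// exprn_ge0//; lra.
have incr (phi : R -> R) : (forall s t, (dev phi x t - dev phi x s) ^+ 2 <= dev_dist2 x s t) ->
    forall k i, (i < 2 ^ k)%N ->
    `|dev phi x (r * dyadic R k i.+1) - dev phi x (r * dyadic R k i)| <= s * (4 / 5) ^+ k.
  move=> hphi k i ik; rewrite -(ger0_norm (sk0 k)) -ler_sqr ?nnegrE// !real_normK ?num_real//.
  exact: (le_trans (hphi _ _) (term k (Ordinal ik))).
have ic := incr cos (fun s t => ler_wpDr (sqr_ge0 (dev sin x t - dev sin x s)) (lexx _)).
have isn := incr sin (fun s t => ler_wpDl (sqr_ge0 (dev cos x t - dev cos x s)) (lexx _)).
have [cc cs] := continuous_charfun_parts.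
have cont (phi : R -> R) : continuous (dev phi x) -> continuous (fun t : R => dev phi x (r * t)).
  by move=> c t; apply: continuous_comp; [exact: mulrl_continuous|exact: c].
have dc0 : dev cos x (r * 0) = 0.
  rewrite mulr0 /dev; under eq_bigr do rewrite mul0r cos0.
  under eq_Rintegral do rewrite mul0r cos0.
  by rewrite Rintegral_cst_probability sumr_const card_ord mulVf// subrr.
have ds0 : dev sin x (r * 0) = 0.
  rewrite mulr0 /dev; under eq_bigr do rewrite mul0r sin0.
  under eq_Rintegral do rewrite mul0r sin0.
  by rewrite Rintegral_cst_probability sumr_const card_ord mul0rn mulr0 subrr.
have Bc := chaining (cont _ (continuous_dev (@continuous_cos R) cc)) dc0 ic.
have Bs := chaining (cont _ (continuous_dev (@continuous_sin R) cs)) ds0 isn.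
have pos t : 0 <= t <= r -> `|dev cos x t| <= 5 * s /\ `|dev sin x t| <= 5 * s.
  move=> /andP[t0 tr]; have t1 : 0 <= t / r <= 1.
    by rewrite divr_ge0 ?(ltW r0)//= ler_pdivrMr// mul1r.
  have rt : r * (t / r) = t by rewrite mulrC divfK// gt_eqF.
  by have := Bc _ t1; have := Bs _ t1; rewrite rt.
move=> t tr; have [t0|/ltW t0] := leP 0 t.
  by apply: pos; rewrite t0/= -(ger0_norm t0).
have dcN : dev cos x t = dev cos x (- t).
  rewrite /dev; congr (_ * _ - _); first by apply: eq_bigr => j _; rewrite mulNr cosN.
  by apply: eq_Rintegral => y _; rewrite mulNr cosN.
have dsN : dev sin x t = - dev sin x (- t).
  have E : \int[nu]_y sin (- t * y) = - \int[nu]_y sin (t * y).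
    rewrite -[RHS]mulN1r -(RintegralZl _ measurableT (sin_integrable t)).
    by apply: eq_Rintegral => y _; rewrite mulNr sinN mulN1r.
  rewrite /dev E opprB addrC; congr (_ + _); rewrite -mulrN; congr (_ * _).
  by rewrite -sumrN; apply: eq_bigr => j _; rewrite mulNr sinN opprK.
rewrite dcN dsN normrN; apply: pos; rewrite oppr_ge0 t0/=.
by rewrite -(ler0_norm t0).
Qed.

End EmpiricalDeviation.

(** * The distinguished logarithm *)

Section ComplexContinuity.
Local Open Scope complex_scope.

Lemma continuous_of_eps_delta (R : realType) (K : numFieldType) (f : K -> R) :
  (forall z e, 0 < e -> exists2 d : K, 0 < d &
     forall y, `|z - y| <= d -> `|f z - f y| <= e) ->
  continuous f.
Proof.
move=> H z; apply/(@cvgrPdist_le _ _ _ _ (nbhs_filter z)) => e /(H z)[d d0 zd].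
by apply: filterS (nbhsx_ballx z d d0) => y /ltW; exact: zd.
Qed.

Lemma continuous_Im (R : realType) :
  continuous (@complex.Im R : (R[i] : numFieldType) -> R).
Proof.
apply: continuous_of_eps_delta => z e e0.
exists e%:C; first by rewrite ltcR.
move=> y zy; rewrite -lecR; apply: le_trans zy.
rewrite normc_def lecR; case: z => a b; case: y => a' b' /=.
by rewrite -sqrtr_sqr ler_wsqrtr// lerDr sqr_ge0.
Qed.

Lemma cvg_complex (R : realType) (u v : R -> R) (t : R) :
  {for t, continuous u} -> {for t, continuous v} ->
  {for t, continuous ((fun s => u s +i* v s) : R -> (R[i] : numFieldType))}.
Proof.
move=> cu cv; apply/cvgrPdist_le => e e0.
(* A positive element of [R[i]] has zero imaginary part, so the radius [e] is in fact real. *)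
have [e' e'0 ee] : exists2 e', 0 < e' & e = e'%:C.
  by case: e e0 => a b; rewrite ltcE/= => /andP[/eqP -> a0]; exists a.
have e2 : 0 < e' / 2 by rewrite divr_gt0.
move/cvgrPdist_le/(_ _ e2) : cu => cu; move/cvgrPdist_le/(_ _ e2) : cv => cv.
near=> s; rewrite ee normc_def lecR /=.
have hu : `|u t - u s| <= e' / 2 by near: s.
have hv : `|v t - v s| <= e' / 2 by near: s.
rewrite -(ger0_norm (ltW e'0)) -sqrtr_sqr ler_wsqrtr//.
move: hu hv; rewrite !ler_norml => /andP[a b] /andP[c d]; nra.
Unshelve. all: by end_near. Qed.

(** The two arguments differ by a multiple of 2 pi; the vanishing sine is the form in which
    continuity will force them to be equal. *)
Lemma cexp_eq_sin (R : realType) (z z' : R[i]) : cexp z = cexp z' ->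
  sin (complex.Im z - complex.Im z') = 0.
Proof.
case: z => a b; case: z' => a' b'; rewrite /cexp /= => -[].
rewrite !mul0r !subr0 !addr0 => E1 E2.
have : expR a * expR a' * sin (b - b') = 0.
  rewrite sinB.
  transitivity ((expR a * sin b) * (expR a' * cos b') -
                (expR a * cos b) * (expR a' * sin b')); first by ring.
  by rewrite E1 E2; ring.
by move/eqP; rewrite mulf_eq0 mulf_eq0 (gt_eqF (expR_gt0 a)) (gt_eqF (expR_gt0 a')) => /eqP.
Qed.

(** If [k t] were nonzero, the intermediate value theorem would make [k] take a nonzero value in
    [-1, 1], where the sine does not vanish. *)
Lemma continuous_sin0_eq0 (R : realType) (k : R -> R) (r : R) : 0 <= r ->
  {within `[- r, r], continuous k} -> k 0 = 0 ->
  (forall t, t \in `[- r, r] -> sin (k t) = 0) ->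
  forall t, t \in `[- r, r] -> k t = 0.
Proof.
move=> r0 ck k0 sk t tr; apply/eqP; apply: contraT => kt0.
have [v [v_between v0 v2]] : exists v,
    [/\ Num.min (k 0) (k t) <= v <= Num.max (k 0) (k t), v != 0 & `|v| <= 1].
  rewrite k0; have [kt|kt] := ltP 0 (k t).
    exists (Num.min 1 (k t)); have m0 : 0 < Num.min 1 (k t) by rewrite lt_min ltr01.
    by rewrite (ltW m0) ge_min lexx orbT gt_eqF// gtr0_norm// ge_min lexx.
  have {}kt : k t < 0 by rewrite lt_neqAle kt0.
  exists (Num.max (-1) (k t)); have m0 : Num.max (-1) (k t) < 0 by rewrite gt_max ltrN10.
  by rewrite (ltW m0) le_max lexx orbT lt_eqF// ltr0_norm// lerNl le_max lexx.
move: tr; rewrite in_itv/= => /andP[tr1 tr2].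
have sub a b : - r <= a -> b <= r -> {within `[a, b], continuous k}.
  by move=> ha hb; apply: continuous_subspaceW ck; apply: subset_itv; rewrite bnd_simp.
have [c cr kc] : exists2 c, c \in `[- r, r] & k c = v.
  have [t0|/ltW t0] := leP 0 t.
    have r0' : - r <= 0 by rewrite oppr_le0.
    have [c] := IVT t0 (sub 0 t r0' tr2) v_between.
    rewrite in_itv/= => /andP[c0 ct] <-; exists c => //.
    by rewrite in_itv/= (le_trans _ c0) ?oppr_le0// (le_trans ct).
  rewrite minC maxC in v_between.
  have [c] := IVT t0 (sub t 0 tr1 r0) v_between.
  rewrite in_itv/= => /andP[c0 ct] <-; exists c => //.
  by rewrite in_itv/= (le_trans _ c0)// (le_trans ct).
have := sk c cr; rewrite kc => sv.
have sin_pos (y : R) : 0 < y -> y <= 1 -> 0 < sin y.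
  by move=> y0 y1; apply: sin2_gt0; rewrite y0/= (le_lt_trans y1)// ltr1n.
move: v2; rewrite ler_norml => /andP[vm1 v1].
move: v0; rewrite neq_lt => /orP[v0|v0].
  have := sin_pos (- v); rewrite oppr_gt0 lerNl sinN sv oppr0 ltxx => /(_ v0 vm1).
  by [].
by have := sin_pos v v0 v1; rewrite sv ltxx.
Qed.

End ComplexContinuity.

Section LogPerturbation.
Local Open Scope complex_scope.

(** In the fallback cases the value is the constant [c]. Hence the integrand of the estimator is
    continuous at every sample point, which gives its integrability. *)
Lemma continuous_Im_distinguished_log (R : realType) (c : R[i]) (r : R) (g : R -> R[i]) :
  {within `[- r, r], continuous (fun t => complex.Im (distinguished_log c r g t))}.
Proof.
rewrite /distinguished_log; case: ifP => _; last by apply: continuous_subspaceT => t; exact: cvg_cst.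
case: xgetP => [l _ [cl _ _]|_]; last by apply: continuous_subspaceT => t; exact: cvg_cst.
move=> t; exact: (cvg_comp _ _ (cl t) (@continuous_Im R (l t))).
Qed.

Section PerturbedPhase.
Context (R : realType) (g : R -> R[i]) (gamma r : R).
Hypotheses (r0 : 0 <= r)
  (cRe : continuous (fun t => complex.Re (g t)))
  (cIm : continuous (fun t => complex.Im (g t))) (g0 : g 0 = 1).

(* [g t * e^(- i gamma t) = rotated_Re t + i rotated_Im t]. *)
Definition rotated_Re t : R :=
  complex.Re (g t) * cos (gamma * t) + complex.Im (g t) * sin (gamma * t).

Definition rotated_Im t : R :=
  complex.Im (g t) * cos (gamma * t) - complex.Re (g t) * sin (gamma * t).

(** The principal argument of g t e^(- i gamma t) when this number lies in the right half-plane. *)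
Definition phase_error t : R := atan (rotated_Im t / rotated_Re t).

Hypothesis Re_gt0 : forall t, t \in `[- r, r] -> 0 < rotated_Re t.

(** An explicit logarithm of [g]: the quotient inside [ln] is the modulus of [g t]. *)
Let l t : R[i] :=
  ln (rotated_Re t / cos (phase_error t)) +i* (gamma * t + phase_error t).

Let cos_gt0 t : 0 < cos (phase_error t).
Proof. by apply: cos_gt0_pihalf; rewrite atan_gtNpi2 atan_ltpi2. Qed.

Let cexp_l t : t \in `[- r, r] -> cexp (l t) = g t.
Proof.
move=> tr; rewrite /cexp /l /=.
have P0 := Re_gt0 tr; have c0 := cos_gt0 t.
rewrite lnK ?posrE ?divr_gt0//.
have sE : rotated_Re t / cos (phase_error t) * sin (phase_error t) = rotated_Im t.
  have : tan (phase_error t) = rotated_Im t / rotated_Re t by rewrite atanK.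
  rewrite /tan => E; by rewrite -[RHS](divfK (lt0r_neq0 P0)) -E; ring.
have cE : rotated_Re t / cos (phase_error t) * cos (phase_error t) = rotated_Re t.
  by rewrite divfK ?gt_eqF.
have := cos2Dsin2 (gamma * t).
rewrite cosD sinD; move: sE cE; rewrite /rotated_Im /rotated_Re.
set M := _ / _; case: (g t) => a b /=.
set C := cos (gamma * t); set S := sin (gamma * t).
set C' := cos (phase_error t); set S' := sin (phase_error t).
move=> sE cE CS; rewrite -[LHS]/(_ +i* _)/= !mul0r subr0 addr0.
congr (_ +i* _).
- transitivity (M * C' * C - M * S' * S); first by ring.
  by rewrite sE cE; transitivity (a * (C ^+ 2 + S ^+ 2)); [ring|rewrite CS mulr1].
- transitivity (M * C' * S + M * S' * C); first by ring.
  by rewrite sE cE; transitivity (b * (C ^+ 2 + S ^+ 2)); [ring|rewrite CS mulr1].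
Qed.

Let continuous_cos_mul : continuous (fun t : R => cos (gamma * t)).
Proof. by move=> t; apply: continuous_comp; [exact: mulrl_continuous|exact: continuous_cos]. Qed.

Let continuous_sin_mul : continuous (fun t : R => sin (gamma * t)).
Proof. by move=> t; apply: continuous_comp; [exact: mulrl_continuous|exact: continuous_sin]. Qed.

Let continuous_rotated_Re : continuous rotated_Re.
Proof.
move=> t; apply: cvgD; apply: cvgM;
  [exact: cRe|exact: continuous_cos_mul|exact: cIm|exact: continuous_sin_mul].
Qed.

Let continuous_rotated_Im : continuous rotated_Im.
Proof.
move=> t; apply: cvgB; apply: cvgM;
  [exact: cIm|exact: continuous_cos_mul|exact: cRe|exact: continuous_sin_mul].
Qed.

Lemma continuous_phase_error t : t \in `[- r, r] -> {for t, continuous phase_error}.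
Proof.
move=> tr; apply: continuous_comp; last exact: continuous_atan.
apply: cvgM; first exact: continuous_rotated_Im.
apply: cvgV; last exact: continuous_rotated_Re.
by rewrite gt_eqF// Re_gt0.
Qed.

Let continuous_phase t : t \in `[- r, r] ->
  {for t, continuous (fun s => gamma * s + phase_error s)}.
Proof.
move=> tr; apply: cvgD; first exact: mulrl_continuous.
exact: continuous_phase_error.
Qed.

Let is_log_l : is_distinguished_log r g l.
Proof.
split.
- apply: continuous_in_subspaceT => t; rewrite mem_setE => tr.
  apply: (@cvg_complex R (fun s => ln (rotated_Re s / cos (phase_error s)))
    (fun s => gamma * s + phase_error s) t); last exact: continuous_phase.
  apply: (@continuous_comp _ _ _ (fun s => rotated_Re s / cos (phase_error s)) (@ln R)).
    apply: cvgM; first exact: continuous_rotated_Re.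
    apply: cvgV; first by rewrite gt_eqF.
    apply: (@continuous_comp _ _ _ phase_error (@cos R)); first exact: continuous_phase_error.
    exact: continuous_cos.
  by apply: continuous_ln; rewrite divr_gt0// Re_gt0.
- exact: cexp_l.
- rewrite /l /phase_error /rotated_Re /rotated_Im g0 /= !mulr0 cos0 sin0.
  by rewrite !mul0r !mulr0 subr0 addr0 mul0r atan0 addr0 cos0 mulr1 divr1 ln1.
Qed.

(** Since [l] is a distinguished logarithm, the choice operator does return one. The two imaginary
    parts differ by a continuous function that is 0 at 0 and whose sine vanishes, hence by 0. *)
Lemma Im_distinguished_log (c : R[i]) t : t \in `[- r, r] ->
  complex.Im (distinguished_log c r g t) = gamma * t + phase_error t.
Proof.
move=> tr.
have gn0 : forall s, s \in `[- r, r] -> g s != 0.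
  move=> s sr; apply/eqP => gs; have := Re_gt0 sr.
  by rewrite /rotated_Re gs /= !mul0r addr0 ltxx.
have [cl' El' l'0] : is_distinguished_log r g (distinguished_log c r g).
  rewrite /distinguished_log asboolT//.
  by case: xgetP => // /(_ l).
apply/eqP; rewrite -subr_eq0; apply/eqP.
have := @continuous_sin0_eq0 R
  (fun s => complex.Im (distinguished_log c r g s) - (gamma * s + phase_error s)) r r0.
apply => //.
- move=> s; apply: cvgB; first exact: continuous_Im_distinguished_log.
  have : {within `[- r, r], continuous (fun s : R => gamma * s + phase_error s)}.
    by apply: continuous_in_subspaceT => u; rewrite mem_setE => ur; exact: (continuous_phase ur).
  exact.
- have l0 : l 0 = 0 by have [] := is_log_l.
  have := congr1 (@complex.Im R) l0; rewrite /l /= => ->.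
  by rewrite l'0 subrr.
- by move=> s sr; apply: (@cexp_eq_sin _ _ (l s)); rewrite El'// cexp_l.
Qed.

End PerturbedPhase.

End LogPerturbation.

(** * The estimator *)

Section Estimator.
Context (R : realType) (w : R -> R) (Wb h : R).
Hypotheses (cw : continuous w) (wW : forall t, `|w t| <= Wb) (h0 : 0 < h)
  (w_moment : \int[@lebesgue_measure R]_(t in `[-1, 1]) (t * w t) = 1).
Local Notation mu := (@lebesgue_measure R).
Local Notation r := (h^-1).

Definition clip (M y : R) : R := Num.max (Num.min y M) (- M).

Lemma clip_lipschitz (M x y : R) : `|clip M x - clip M y| <= `|x - y|.
Proof.
have xy := ler_norm (x - y); have yx := ler_norm (y - x); rewrite (distrC y x) in yx.
apply: (@le_trans _ _ `|Num.min x M - Num.min y M|).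
  have := ler_norm (Num.min x M - Num.min y M); have := ler_norm (Num.min y M - Num.min x M).
  rewrite (distrC (Num.min y M)) /clip; set u := Num.min x M; set v := Num.min y M => vu uv.
  by rewrite ler_norml; case: (leP u (- M)) => ?; case: (leP v (- M)) => ?; lra.
by rewrite ler_norml; case: (leP x M) => ?; case: (leP y M) => ?; lra.
Qed.

Lemma clip_id (M x : R) : `|x| <= M -> clip M x = x.
Proof. by rewrite ler_norml => /andP[a b]; rewrite /clip min_l// max_l. Qed.

Lemma norm_clip_le (M x : R) : 0 <= M -> `|clip M x| <= M.
Proof.
move=> M0; rewrite ler_norml /clip le_max lexx orbT/= ge_max ge_min lexx orbT/=; lra.
Qed.

Lemma continuous_clip (M : R) : continuous (clip M).
Proof.
apply: (@continuous_of_sqr_dist_le _ _ 1) => // s t.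
by rewrite mul1r -real_normK ?num_real// -[leRHS]real_normK ?num_real// lerXn2r ?nnegrE// clip_lipschitz.
Qed.

Lemma continuous_rescaled : continuous (rescaled w h).
Proof.
move=> t; apply: cvgM; first exact: cvg_cst.
by apply: continuous_comp; [exact: mulrl_continuous|exact: cw].
Qed.

(** Substitution of h t for the variable: one factor [h] goes to the variable and one to its
    differential. The weighted integral of [gamma * t] is therefore exactly [gamma]. *)
Lemma rescaled_moment :
  \int[mu]_(t in `[- r, r]) (t * rescaled w h t) = 1.
Proof.
have rr : - r <= r. by have := invr_gt0 h; rewrite h0 => /idP r0; lra.
have dF : derive1 ( *%R h) = cst h.
  by apply/funext => t; rewrite (derive1Ml (f := id) h)// derive1_id mulr1.
have hr : h * r = 1 by rewrite mulfV// gt_eqF.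
have hNr : h * - r = -1 by rewrite mulrN hr.
rewrite -w_moment /Rintegral; congr fine.
have := @integration_by_substitution_increasing R ( *%R h) (fun t => t * w t) (- r) r rr.
have cF (t : R) : {for t, continuous ( *%R h)} by exact: mulrl_continuous.
rewrite hr hNr => -> //.
- by apply: eq_integral => t _; rewrite dF -[RHS]/((h * t * w (h * t) * h)%:E) /rescaled; congr EFin; ring.
- by move=> x y _ _ xy; rewrite ltr_pM2l.
- by rewrite dF => t _; exact: cvg_cst.
- by rewrite dF; exact: is_cvg_cst.
- by rewrite dF; exact: is_cvg_cst.
- split.
  + by move=> t _; exact: derivableM.
  + by apply: cvg_at_right_filter; exact: cF.
  + by apply: cvg_at_left_filter; exact: cF.
- apply: continuous_subspaceT => t; apply: cvgM; [exact: cvg_id|exact: cw].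
Qed.

(** Writing [gamma] as the weighted integral of [gamma * t] leaves an integrand of size at most
    [kappa * (h ^+ 2 * Wb)] on an interval of length 2 / h. *)
Lemma weighted_error (f : R -> R) (gamma kappa : R) :
  {within `[- r, r], continuous f} ->
  (forall t, t \in `[- r, r] -> `|f t - gamma * t| <= kappa) ->
  `|\int[mu]_(t in `[- r, r]) (f t * rescaled w h t) - gamma| <= 2 * kappa * h * Wb.
Proof.
move=> cf fk.
have K0 : 0 <= kappa.
  have /fk : (0 : R) \in `[- r, r] by rewrite in_itv/= oppr_le0 invr_ge0 ltW.
  by apply: le_trans.
have Wb0 : 0 <= Wb by apply: le_trans (wW 0).
have int (u : R -> R) : {within `[- r, r], continuous u} -> mu.-integrable `[- r, r] (EFin \o u).
  by apply: continuous_compact_integrable; exact: segment_compact.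
have cr : {within `[- r, r], continuous (rescaled w h)}.
  by apply: continuous_subspaceT; exact: continuous_rescaled.
have cid : {within `[- r, r], continuous (fun t : R => t)}.
  by apply: continuous_subspaceT => t; exact: cvg_id.
have mI : measurable (`[- r, r]%classic : set (measurableTypeR R)) by exact: measurable_itv.
have i1 : mu.-integrable `[- r, r] (EFin \o (fun t => f t * rescaled w h t)).
  by apply: int => t; apply: cvgM; [exact: cf|exact: cr].
have i2 : mu.-integrable `[- r, r] (EFin \o (fun t => t * rescaled w h t)).
  by apply: int => t; apply: cvgM; [exact: cid|exact: cr].
have i3 : mu.-integrable `[- r, r] (EFin \o (fun t => gamma * (t * rescaled w h t))).
  by have := integrableZl mI gamma i2.
have gE : \int[mu]_(t in `[- r, r]) (gamma * (t * rescaled w h t)) = gamma.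
  by rewrite (RintegralZl _ mI i2) rescaled_moment mulr1.
rewrite -[X in _ - X]gE -(RintegralB mI i1 i3).
have i4 : mu.-integrable `[- r, r] (EFin \o (fun t => f t * rescaled w h t - gamma * (t * rescaled w h t))).
  by have := integrableB mI i1 i3.
apply: (le_trans (le_normr_Rintegral mI i4)).
have i5 : mu.-integrable `[- r, r] (EFin \o cst (kappa * (h ^+ 2 * Wb))).
  by apply: int; apply: continuous_subspaceT => t; exact: cvg_cst.
have i6 : mu.-integrable `[- r, r] (EFin \o (fun t => `|f t * rescaled w h t - gamma * (t * rescaled w h t)|)).
  by have := integrable_norm i4.
apply: (le_trans (le_Rintegral mI i6 i5 _)).
  move=> t tr; rewrite mulrA -mulrBl normrM ler_pM//; first exact: fk.
  by rewrite /rescaled normrM ger0_norm ?sqr_ge0// ler_wpM2l// sqr_ge0.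
have muI : mu `[- r, r]%classic = (r - - r)%:E.
  by rewrite lebesgue_measure_itv/= lte_fin gtrN ?invr_gt0.
rewrite Rintegral_cst// [X in fine X]muI /= le_eqVlt; apply/orP; left; apply/eqP; field.
by rewrite gt_eqF.
Qed.

End Estimator.

(** * Regularity of the empirical characteristic function *)

Section EmpiricalCharfun.
Context (R : realType) (n : nat) (x : 'I_n -> R).

Lemma continuous_Re_empirical : continuous (fun t : R => complex.Re (empirical_charfun x t)).
Proof.
rewrite (_ : (fun t : R => _) = (fun t : R => n%:R^-1 * \sum_(j < n) cos (t * x j))).
  exact: continuous_mean_comp (@continuous_cos R).
by apply/funext => t; rewrite Re_empirical.
Qed.

Lemma continuous_Im_empirical : continuous (fun t : R => complex.Im (empirical_charfun x t)).
Proof.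
rewrite (_ : (fun t : R => _) = (fun t : R => n%:R^-1 * \sum_(j < n) sin (t * x j))).
  exact: continuous_mean_comp (@continuous_sin R).
by apply/funext => t; rewrite Im_empirical.
Qed.

Lemma empirical_charfun0 : (0 < n)%N -> empirical_charfun x 0 = 1.
Proof.
move=> n0; have nn0 : n%:R != 0 :> R by rewrite pnatr_eq0 -lt0n.
apply/eqP; rewrite eq_complex Re_empirical Im_empirical /=.
under eq_bigr do rewrite mul0r cos0.
under [X in _ && (_ * X == _)]eq_bigr do rewrite mul0r sin0.
by rewrite !sumr_const card_ord mulVf// mul0rn mulr0 !eqxx.
Qed.

End EmpiricalCharfun.

(** * Risk bound at a fixed sample size *)

Section Risk.
Context (R : realType) (w : R -> R) (Wb h M gamma eps V : R) (nu : probability R R) (a : R -> R).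
Hypotheses (cw : continuous w) (Wb0 : 0 < Wb) (wW : forall t, `|w t| <= Wb) (h0 : 0 < h)
  (w_moment : \int[@lebesgue_measure R]_(t in `[-1, 1]) (t * w t) = 1)
  (gM : `|gamma| * h^-1 <= M) (eps0 : 0 < eps)
  (nuV : forall u : R, 1 - \int[nu]_x cos (u * x) <= V * u ^+ 2 / 2)
  (nu_cos : forall t, \int[nu]_x cos (t * x) = a t * cos (gamma * t))
  (nu_sin : forall t, \int[nu]_x sin (t * x) = a t * sin (gamma * t))
  (a_eps : forall t, `|t| <= h^-1 -> eps <= a t).

(** The factor relating the squared error to [chain_sum]. The first summand is the squared
    coefficient of the bound for small deviations; the second is the squared crude error times (20 /
    eps)^2, for deviations beyond the threshold eps / 20. *)
Definition risk_const : R :=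
  ((40 * h * Wb) ^+ 2 + (20 * (2 * M * h * Wb + `|gamma|)) ^+ 2) / eps ^+ 2.

Let M0 : 0 <= M.
Proof. by apply: le_trans gM; rewrite mulr_ge0// invr_ge0 ltW. Qed.

Let itvP t : t \in `[- h^-1, h^-1] -> `|t| <= h^-1.
Proof. by rewrite in_itv/= ler_norml. Qed.

Let clipE c n (x : 'I_n -> R) : gamma_tilde w h M c x =
  \int[@lebesgue_measure R]_(t in `[- h^-1, h^-1])
    (clip M (complex.Im (distinguished_log c h^-1 (empirical_charfun x) t)) * rescaled w h t).
Proof. by []. Qed.

Let continuous_clip_log c n (x : 'I_n -> R) : {within `[- h^-1, h^-1],
  continuous (fun t : R => clip M (complex.Im (distinguished_log c h^-1 (empirical_charfun x) t)))}.
Proof.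
pose f := fun t => complex.Im (distinguished_log c h^-1 (empirical_charfun x) t).
have cf : {within `[- h^-1, h^-1], continuous f} by exact: continuous_Im_distinguished_log.
move=> t; exact: (cvg_comp _ _ (cf t) (@continuous_clip R M (f t))).
Qed.

(** The truncated phase is compared with the zero phase, at distance at most [M]. *)
Lemma gamma_tilde_error_crude c n (x : 'I_n -> R) :
  `|gamma_tilde w h M c x - gamma| <= 2 * M * h * Wb + `|gamma|.
Proof.
rewrite (le_trans (ler_normB _ _))// lerD2r clipE.
have := @weighted_error R w Wb h cw wW h0 w_moment _ 0 M (@continuous_clip_log c n x).
rewrite subr0; apply => t _; rewrite mul0r subr0; exact: norm_clip_le.
Qed.

Lemma phase_error_le n (x : 'I_n -> R) (s t : R) : 0 <= s -> 20 * s <= eps ->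
  (forall t, `|t| <= h^-1 -> `|dev nu cos x t| <= 5 * s /\ `|dev nu sin x t| <= 5 * s) ->
  `|t| <= h^-1 ->
  0 < rotated_Re (empirical_charfun x) gamma t /\
  `|phase_error (empirical_charfun x) gamma t| <= 20 * s / eps.
Proof.
move=> s0 s_eps devs tr; have [] := devs t tr; have := a_eps tr.
rewrite /dev nu_cos nu_sin /phase_error /rotated_Re /rotated_Im Re_empirical Im_empirical.
set A := _ * \sum_(j < n) cos _; set B := _ * \sum_(j < n) sin _ => ae.
set C := cos (gamma * t); set S := sin (gamma * t).
have CS : C ^+ 2 + S ^+ 2 = 1 := cos2Dsin2 _.
have C1 : `|C| <= 1 := cos_max _; have S1 : `|S| <= 1 := sin_max _.
have combo (p q u v : R) : `|p| <= 5 * s -> `|q| <= 5 * s -> `|u| <= 1 -> `|v| <= 1 ->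
    `|p * u + q * v| <= 10 * s.
  move=> hp hq hu hv; rewrite (le_trans (ler_normD _ _))// !normrM.
  have : `|p| * `|u| <= 5 * s by rewrite -[leRHS]mulr1 ler_pM.
  have : `|q| * `|v| <= 5 * s by rewrite -[leRHS]mulr1 ler_pM.
  lra.
set dc := A - a t * C; set ds := B - a t * S => hdc hds.
have ReE : A * C + B * S = a t + (dc * C + ds * S).
  rewrite /dc /ds -[X in X + _ = _]mulr1.
  transitivity (a t * (C ^+ 2 + S ^+ 2) + (A - a t * C) * C + (B - a t * S) * S); first by ring.
  by rewrite CS; ring.
have ImE : B * C - A * S = ds * C + dc * (- S) by rewrite /dc /ds; ring.
have h1 := combo _ _ _ _ hdc hds C1 S1.
have h2 : `|ds * C + dc * (- S)| <= 10 * s by apply: combo; rewrite ?normrN.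
have Re_ge : eps / 2 <= A * C + B * S.
  by rewrite ReE; move: h1; rewrite ler_norml => /andP[h1 _]; lra.
have P0 : 0 < A * C + B * S by apply: lt_le_trans Re_ge; rewrite divr_gt0.
split => //; apply: (le_trans (norm_atan_le _)).
rewrite normrM normfV (gtr0_norm P0) ler_pdivrMr// ImE (le_trans h2)//.
have : 20 * s / eps * (eps / 2) <= 20 * s / eps * (A * C + B * S).
  by rewrite ler_wpM2l// divr_ge0 ?(ltW eps0)// mulr_ge0.
by have -> : 20 * s / eps * (eps / 2) = 10 * s by field; rewrite gt_eqF.
Qed.

(** Truncation is 1-Lipschitz and, by [gM], fixes [gamma * t]; so the truncated phase is as close to
    [gamma * t] as the phase itself. *)
Lemma gamma_tilde_error_fine c n (x : 'I_n -> R) (s : R) : (0 < n)%N ->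
  0 <= s -> 20 * s <= eps ->
  (forall t, `|t| <= h^-1 -> `|dev nu cos x t| <= 5 * s /\ `|dev nu sin x t| <= 5 * s) ->
  `|gamma_tilde w h M c x - gamma| <= 2 * (20 * s / eps) * h * Wb.
Proof.
move=> n0 s0 s_eps devs; rewrite clipE.
apply: (@weighted_error R w Wb h cw wW h0 w_moment _ gamma _ (@continuous_clip_log c n x)).
move=> t tr; have [_ pe] := phase_error_le s0 s_eps devs (itvP tr).
have gt : `|gamma * t| <= M.
  by apply: le_trans gM; rewrite normrM ler_wpM2l// itvP.
rewrite -[X in _ - X](clip_id gt); apply: (le_trans (clip_lipschitz _ _ _)).
have nn0 : n%:R != 0 :> R by rewrite pnatr_eq0 -lt0n.
rewrite (Im_distinguished_log (gamma := gamma))//; first by rewrite addrAC subrr add0r.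
- by rewrite invr_ge0 ltW.
- exact: continuous_Re_empirical.
- exact: continuous_Im_empirical.
- exact: empirical_charfun0.
- by move=> u ur; have [] := phase_error_le s0 s_eps devs (itvP ur).
Qed.

(** Let S be [chain_sum]. If S is at most (eps / 20)^2, the fine bound applies with [s] the square
    root of S; otherwise (20 / eps)^2 S exceeds 1 and multiplies the crude bound. Both cases are
    linear in S, ready for integration. *)
Lemma gamma_tilde_sqr_error c n (x : 'I_n -> R) : (0 < n)%N ->
  (((gamma_tilde w h M c x - gamma) ^+ 2)%:E <= risk_const%:E * chain_sum nu h^-1 x)%E.
Proof.
move=> n0.
have r0 : 0 < h^-1 by rewrite invr_gt0.
have e20 : 0 < eps ^+ 2 by rewrite exprn_gt0.
have S0 := chain_sum_ge0 nu h^-1 x.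
have p1 : 0 < (40 * h * Wb) ^+ 2 by rewrite exprn_gt0// !mulr_gt0// ltr0n.
have p2 := sqr_ge0 (20 * (2 * M * h * Wb + `|gamma|)).
have B0 : 0 < risk_const by rewrite divr_gt0// ltr_wpDr.
have [SE|SE] := leP (chain_sum nu h^-1 x) ((eps / 20) ^+ 2)%:E.
  have Sfin : chain_sum nu h^-1 x \is a fin_num.
    by rewrite ge0_fin_numE// (le_lt_trans SE)// ltry.
  have [q SEq] : exists q, chain_sum nu h^-1 x = q%:E.
    by exists (fine (chain_sum nu h^-1 x)); rewrite fineK.
  rewrite SEq lee_fin in SE S0 *; rewrite lee_fin in S0.
  have s2 : Num.sqrt q ^+ 2 = q by rewrite sqr_sqrtr.
  have se : 20 * Num.sqrt q <= eps.
    have : Num.sqrt q <= eps / 20.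
      have e0 : 0 <= eps / 20 by rewrite divr_ge0 ?(ltW eps0).
      by rewrite -(ger0_norm e0) -sqrtr_sqr ler_wsqrtr.
    lra.
  have devs := @chain_sum_sup R nu V nuV h^-1 n x (Num.sqrt q) n0 r0 (sqrtr_ge0 _).
  rewrite s2 SEq lexx in devs.
  have err := gamma_tilde_error_fine c n0 (sqrtr_ge0 _) se (devs isT).
  rewrite -real_normK ?num_real//.
  apply: (@le_trans _ _ ((2 * (20 * Num.sqrt q / eps) * h * Wb) ^+ 2)).
    by rewrite lerXn2r// nnegrE (le_trans _ err).
  have -> : (2 * (20 * Num.sqrt q / eps) * h * Wb) ^+ 2 = (40 * h * Wb) ^+ 2 / eps ^+ 2 * q.
    by rewrite -[in RHS]s2; field; rewrite gt_eqF.
  by rewrite ler_wpM2r// ler_wpM2r ?invr_ge0 ?(ltW e20)// lerDl.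
have err := gamma_tilde_error_crude c x.
apply: (@le_trans _ _ (risk_const%:E * ((eps / 20) ^+ 2)%:E)%E); last first.
  by rewrite lee_wpmul2l// ?lee_fin ltW.
rewrite -EFinM lee_fin -real_normK ?num_real//.
apply: (@le_trans _ _ ((2 * M * h * Wb + `|gamma|) ^+ 2)).
  by rewrite lerXn2r// nnegrE (le_trans _ err).
have -> : risk_const * (eps / 20) ^+ 2 = (2 * h * Wb) ^+ 2 + (2 * M * h * Wb + `|gamma|) ^+ 2.
  by rewrite /risk_const; field; rewrite gt_eqF.
by rewrite lerDr sqr_ge0.
Qed.

Lemma gamma_tilde_risk n d (T : measurableType d) (P : probability T R)
    (X : 'I_n -> {RV P >-> R}) (c : R[i]) : (0 < n)%N -> iid_sample nu X ->
  ('E_P[fun om => ((gamma_tilde w h M c (fun j => X j om) - gamma) ^+ 2)%R]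
   <= (risk_const * (5 * V * (h^-1) ^+ 2 / n%:R))%:E)%E.
Proof.
move=> n0 iidX; rewrite unlock.
apply: (@le_trans _ _ (\int[P]_om (risk_const%:E * chain_sum nu h^-1 (fun j => X j om)))%E).
  apply: ge0_le_integral_lower => om; first by rewrite lee_fin sqr_ge0.
  exact: gamma_tilde_sqr_error.
have B0 : 0 <= risk_const.
  by rewrite divr_ge0 ?addr_ge0 ?sqr_ge0.
have S0 om : [set: T] om -> (0 <= chain_sum nu h^-1 (fun j => X j om))%E.
  by move=> _; exact: chain_sum_ge0.
have mS := measurable_chain_sum nu h^-1 X.
rewrite (ge0_integralZl_EFin P measurableT S0 mS B0) [leRHS]EFinM lee_wpmul2l ?lee_fin//.
exact: chain_sum_mean.
Qed.

End Risk.

(** * Asymptotics *)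

Lemma compact_support_bounded (R : realType) (w : R -> R) :
  continuous w -> (forall t, t \notin `[-1, 1] -> w t = 0) ->
  exists2 B, 0 < B & forall t, `|w t| <= B.
Proof.
move=> cw w0.
have cnw : {within `[-1, 1], continuous (fun t => `|w t|)}.
  apply: continuous_subspaceT => t; apply: cvg_norm; exact: cw.
have N11 : -1 <= 1 :> R by lra.
have [c _ wc] := EVT_max N11 cnw.
(* The added 1 makes the bound strictly positive even if [w] vanishes. *)
exists (`|w c| + 1) => [|t]; first by rewrite ltr_wpDl.
have [tI|tI] := boolP (t \in `[-1, 1]); last by rewrite w0// normr0 addr_ge0.
by rewrite (le_trans (wc t tI))// lerDl.
Qed.

(* From [ln y < y] at [y = l delta / q]. *)
Lemma powR_le_expR (R : realType) (q delta l : R) : 0 < q -> 0 < delta -> 0 < l ->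
  l `^ q <= expR (q * ln (q / delta)) * expR (delta * l).
Proof.
move=> q0 d0 l0; rewrite /powR gt_eqF// -expRD ler_expR.
have qd : 0 < q / delta by rewrite divr_gt0.
have E : l = (q / delta) * (l * delta / q) by field; rewrite !gt_eqF.
have y0 : 0 < l * delta / q by rewrite divr_gt0// mulr_gt0.
rewrite {1}E lnM ?posrE// mulrDr lerD2l.
have := ltW (ln_sublinear y0); rewrite -(ler_pM2l q0) => /le_trans; apply.
by rewrite le_eqVlt; apply/orP; left; apply/eqP; field; rewrite gt_eqF.
Qed.

Lemma bandwidth_gt0 (R : realType) (eta : R) n : 0 < eta * ln n%:R -> 0 < bandwidth eta n.
Proof. exact: powR_gt0. Qed.

Lemma bandwidth_expN2 (R : realType) (eta : R) n : 0 < eta * ln n%:R ->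
  bandwidth eta n ^- 2 = eta * ln n%:R.
Proof.
move=> el; rewrite /bandwidth -powR_mulrn ?powR_ge0// -powRrM.
rewrite (_ : - 2^-1 * 2 = -1); last by field.
by rewrite powRN powRr1 ?invrK// ltW.
Qed.

(* Here [l] stands for [ln n], and the last argument of [risk_const] is the
   lower bound of [|phi_X|] on [[- h^-1, h^-1]]. *)
Lemma risk_asymptotics (R : realType) (Wb eta Sigma Lambda V Gamma delta beta l m h M : R) :
  0 < eta -> 1 <= l -> `|m| <= l -> 0 < h -> h ^- 2 = eta * l -> M = m * h ^- 2 ->
  0 <= Wb -> 0 <= V -> 0 < Gamma -> 0 < delta -> 0 < beta -> delta = 1 - Sigma ^+ 2 * eta ->
  forall gamma, `|gamma| <= Gamma ->
  risk_const Wb h M gamma (expR (- (Sigma ^+ 2 * (eta * l) / 2 + 2 * Lambda)))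
    * (5 * V * h^-1 ^+ 2 / expR l) <=
  ((40 * Wb) ^+ 2 / eta + 20 ^+ 2 * (2 * (2 * Wb) ^+ 2 * eta + 2 * Gamma ^+ 2)) *
    (5 * V * eta) * expR (4 * Lambda) * expR ((beta + 6) * ln ((beta + 6) / delta))
    * l `^ (- beta - 2).
Proof.
move=> eta0 l1 ml h0 hE ME Wb0 V0 G0 d0 beta0 dE gamma gG.
have l0 : 0 < l by lra.
set C1 := _ / eta + _.
have el : 0 < eta * l by rewrite mulr_gt0.
have h2 : h ^+ 2 = (eta * l)^-1 by rewrite -hE invrK.
have Mh : (M * h) ^+ 2 = m ^+ 2 * (eta * l).
  rewrite ME -hE; field; rewrite gt_eqF//.
have l3 : 1 <= l ^+ 3 by rewrite exprn_ege1.
(* The dominant term is (M h)^2 = m^2 eta l, at most eta l^3; the others are raised to the order l^3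
   by [1 <= l]. *)
have num : (40 * h * Wb) ^+ 2 + (20 * (2 * M * h * Wb + `|gamma|)) ^+ 2 <= C1 * l ^+ 3.
  have e1 : (40 * h * Wb) ^+ 2 <= (40 * Wb) ^+ 2 / eta * l ^+ 3.
    have -> : (40 * h * Wb) ^+ 2 = (40 * Wb) ^+ 2 * (eta^-1 * l^-1).
      by rewrite -invfM -h2; ring.
    have c0 : 0 <= (40 * Wb) ^+ 2 / eta by rewrite divr_ge0 ?sqr_ge0// ltW.
    by rewrite mulrA ler_wpM2l// (le_trans _ l3)// invf_le1.
  have e2 : (2 * M * h * Wb + `|gamma|) ^+ 2 <= (2 * (2 * Wb) ^+ 2 * eta + 2 * Gamma ^+ 2) * l ^+ 3.
    apply: (@le_trans _ _ (2 * (2 * Wb) ^+ 2 * (M * h) ^+ 2 + 2 * `|gamma| ^+ 2)).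
      by have := sqr_ge0 (2 * M * h * Wb - `|gamma|); nra.
    have g2 : `|gamma| ^+ 2 <= Gamma ^+ 2 by rewrite lerXn2r// nnegrE ltW.
    have m2 : m ^+ 2 <= l ^+ 2 by rewrite -real_normK ?num_real// lerXn2r// nnegrE ltW.
    have f1 : (M * h) ^+ 2 <= eta * l ^+ 3.
      by rewrite Mh; have -> : eta * l ^+ 3 = l ^+ 2 * (eta * l); [ring|rewrite ler_wpM2r// ltW].
    have f2 : `|gamma| ^+ 2 <= Gamma ^+ 2 * l ^+ 3.
      by rewrite (le_trans g2)// ler_peMr// sqr_ge0.
    have f3 : (2 * Wb) ^+ 2 * (M * h) ^+ 2 <= (2 * Wb) ^+ 2 * (eta * l ^+ 3).
      by rewrite ler_wpM2l// sqr_ge0.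
    lra.
  by rewrite [(20 * _) ^+ 2]exprMn /C1 [leRHS]mulrDl lerD// -[leRHS]mulrA ler_wpM2l// sqr_ge0.
rewrite /risk_const.
set e := expR _; have e0 : 0 < e by exact: expR_gt0.
(* The squared inverse of the lower bound grows like exp (Sigma^2 eta l), which division by the
   sample size exp l turns into the decay exp (- delta l). *)
have eE : e ^- 2 / expR l = expR (4 * Lambda) * expR (- (delta * l)).
  by rewrite /e -expRM_natl -!expRN -!expRD dE; congr expR; field.
have C10 : 0 <= C1.
  have c1 : 0 <= (40 * Wb) ^+ 2 / eta by rewrite divr_ge0 ?sqr_ge0// ltW.
  have c2 : 0 <= (2 * Wb) ^+ 2 * eta by rewrite mulr_ge0 ?sqr_ge0// ltW.
  have c3 := sqr_ge0 Gamma.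
  have c4 : 0 <= 2 * (2 * Wb) ^+ 2 * eta + 2 * Gamma ^+ 2 by lra.
  by rewrite /C1 addr_ge0// mulr_ge0// sqr_ge0.
apply: (@le_trans _ _ (C1 * l ^+ 3 * (5 * V * (eta * l)) * (e ^- 2 / expR l))).
  rewrite exprVn hE.
  set N := _ + _ in num *.
  have -> : N / e ^+ 2 * (5 * V * (eta * l) / expR l) = N * (5 * V * (eta * l)) * (e ^- 2 / expR l) by ring.
  have E0 : 0 <= e ^- 2 / expR l by rewrite eE mulr_ge0// expR_ge0.
  have A0 : 0 <= 5 * V * (eta * l) by rewrite !mulr_ge0// ltW.
  by rewrite ler_wpM2r// ler_wpM2r.
rewrite eE.
(* The exponent collects 3 from [num], 1 from h^-2, and beta + 2 from moving the target rate to the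
   left-hand side. *)
have pE := powR_le_expR (_ : 0 < beta + 6) d0 l0.
have lp : l `^ (beta + 6) = l ^+ 4 * l `^ (beta + 2).
  rewrite -(powR_mulrn 4 (ltW l0)) -powRD; first by congr (_ `^ _); ring.
  by rewrite (gt_eqF l0) implybT.
have pinv : l `^ (- beta - 2) * l `^ (beta + 2) = 1.
  rewrite -powRD ?(gt_eqF l0) ?implybT// (_ : - beta - 2 + (beta + 2) = 0) ?powRr0//; ring.
have p0 : 0 < l `^ (beta + 2) by exact: powR_gt0.
rewrite -(ler_pM2r p0) -[leRHS]mulrA pinv mulr1.
set D := expR (_ * ln _) in pE *.
have -> : C1 * l ^+ 3 * (5 * V * (eta * l)) * (expR (4 * Lambda) * expR (- (delta * l))) * l `^ (beta + 2)
  = C1 * (5 * V * eta) * expR (4 * Lambda) * (l `^ (beta + 6) * expR (- (delta * l))).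
  by rewrite lp; ring.
have F0 : 0 <= C1 * (5 * V * eta) * expR (4 * Lambda).
  by rewrite !mulr_ge0 ?expR_ge0// ltW.
rewrite -[leRHS]/(C1 * (5 * V * eta) * expR (4 * Lambda) * D) ler_wpM2l//.
rewrite expRN ler_pdivrMr ?expR_gt0//; apply: pE; lra.
Qed.

(** * Uniformity over the symmetric class and conclusion *)

(** The fixed-sample bound with [eps] and [V] chosen from the class parameters: [Sigma] replaces
    [sigma] in the lower bound of the modulus, and [V] adds the contribution Gamma^2 of the drift to
    that of the modulus. *)
Lemma symmetric_levy_risk (R : realType) (w : R -> R)
    (Wb h M gamma sigma Gamma Sigma Lambda K beta L q : R) (rho : R -> R)
    (nu : probability R R) :
  continuous w -> 0 < Wb -> (forall t, `|w t| <= Wb) -> 0 < h -> 0 < K -> 0 < Lambda ->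
  \int[@lebesgue_measure R]_(t in `[-1, 1]) (t * w t) = 1 ->
  `|gamma| * h^-1 <= M -> `|gamma| <= Gamma -> 0 < sigma <= Sigma -> h ^- 2 = q ->
  W_sym beta L Lambda K rho -> charfun nu = levy_charfun gamma sigma rho ->
  forall (d : measure_display) (T : measurableType d) (P : probability T R) n
    (X : 'I_n -> {RV P >-> R}) (c : R[i]%C), (0 < n)%N -> iid_sample nu X ->
  ('E_P[fun om => ((gamma_tilde w h M c (fun j => X j om) - gamma) ^+ 2)%R]
   <= (risk_const Wb h M gamma (expR (- (Sigma ^+ 2 * q / 2 + 2 * Lambda)))
       * (5 * (Sigma ^+ 2 + Lambda * K + Gamma ^+ 2) * (h^-1) ^+ 2 / n%:R))%:E)%E.
Proof.
move=> cw Wb0 wW h0 K0 L0 w1 gM gG /andP[s0 sS] hq rhoW nuE d T P n X c n0 iidX.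
have [a aP] := levy_charfun_symmetric gamma sigma rhoW.
have nu_cos t : \int[nu]_x cos (t * x) = a t * cos (gamma * t).
  by rewrite -Re_charfun nuE; have [-> _ _ _] := aP t.
have nu_sin t : \int[nu]_x sin (t * x) = a t * sin (gamma * t).
  by rewrite -Im_charfun nuE; have [-> _ _ _] := aP t.
have S2 : sigma ^+ 2 <= Sigma ^+ 2 by rewrite lerXn2r// nnegrE ltW// (lt_le_trans s0).
have G2 : gamma ^+ 2 <= Gamma ^+ 2.
  by rewrite -real_normK ?num_real// lerXn2r// nnegrE (le_trans _ gG).
apply: (@gamma_tilde_risk R w Wb h M gamma _ _ nu a) => //.
- exact: expR_gt0.
- move=> u; rewrite nu_cos; have [_ alo a1 ahi] := aP u.
  have a0 : 0 <= a u by apply: le_trans alo; exact: expR_ge0.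
  have := one_sub_cos_le (gamma * u); have c1 := cos_le1 (gamma * u).
  rewrite exprMn; set C := cos _ in c1 *; set A := a u in a0 a1 ahi alo *.
  (* This says 1 - A C <= (1 - A) + (1 - C), which separates the modulus from the drift. *)
  move=> hC; have : 0 <= (1 - A) * (1 - C) by rewrite mulr_ge0// subr_ge0.
  have u2 := sqr_ge0 u.
  have := ler_wpM2r u2 G2; have := ler_wpM2r u2 S2; lra.
- move=> t th; have [_ alo _ _] := aP t; apply: le_trans alo.
  rewrite ler_expR lerN2 lerD2r ler_pM2r//.
  have t2 : t ^+ 2 <= q.
    rewrite -hq -exprVn -real_normK ?num_real// lerXn2r// nnegrE (le_trans _ th)//.
  by rewrite ler_pM// sqr_ge0.
Qed.

Unset Implicit Arguments.

Theorem theorem2p4 (R : realType) (beta L Lambda K Sigma Gamma : R)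
  (hbeta : 0 < beta) (hL : 0 < L) (hLambda : 0 < Lambda) (hK : 0 < K)
  (hSigma : 0 < Sigma) (hGamma : 0 < Gamma)
  (w : R -> R) (w_cont : continuous w)
  (w_supp : forall t, t \notin `[-1, 1] -> w t = 0)
  (w_moment : \int[@lebesgue_measure R]_(t in `[-1, 1]) (t * w t) = 1)
  (w_bigO : (w : R -> R^o) =O_ ((0 : R)^') (fun t : R => `|t| `^ beta : R^o))
  (eta : R) (heta : 0 < eta < Sigma ^- 2)
  (m : nat -> R) (m_dvg : m @ \oo --> +oo)
  (m_slow : (m : nat -> R^o) =o_ \oo (fun n => ln n%:R : R^o))
  (M : nat -> R)
  (M_def : forall n, M n = m n * bandwidth eta n ^- 2)
  (M_pos : forall n, (1 < n)%N -> 0 < M n) :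
  exists (A : R) (n0 : nat), 0 < A /\
    forall n, (n0 <= n)%N ->
    forall gamma sigma : R, `|gamma| <= Gamma -> 0 < sigma <= Sigma ->
    forall rho, W_sym beta L Lambda K rho ->
    forall nu : probability R R, charfun nu = levy_charfun gamma sigma rho ->
    forall (d : measure_display) (T : measurableType d) (P : probability T R)
      (X : 'I_n -> {RV P >-> R}), iid_sample nu X ->
    forall c : R[i],
      ('E_P[fun omega =>
              ((gamma_tilde w (bandwidth eta n) (M n) c (fun j => X j omega) - gamma) ^+ 2)%R]
       <= (A * ln n%:R `^ (- beta - 2))%:E)%E.
Proof.
have [Wb Wb0 wW] := compact_support_bounded w_cont w_supp.
have [eta0 etaS] := andP heta.
(* The risk is a power of ln n times n^(- delta); positivity of [delta] is exactly
   [eta < Sigma ^- 2]. *)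
pose delta := 1 - Sigma ^+ 2 * eta.
have d0 : 0 < delta.
  by rewrite subr_gt0 mulrC -ltr_pdivlMr ?exprn_gt0// div1r.
pose V := Sigma ^+ 2 + Lambda * K + Gamma ^+ 2.
have V0 : 0 < V by rewrite !addr_gt0// ?mulr_gt0 ?exprn_gt0.
pose A := ((40 * Wb) ^+ 2 / eta + 20 ^+ 2 * (2 * (2 * Wb) ^+ 2 * eta + 2 * Gamma ^+ 2)) *
    (5 * V * eta) * expR (4 * Lambda) * expR ((beta + 6) * ln ((beta + 6) / delta)).
have A0 : 0 < A.
  rewrite !mulr_gt0 ?expR_gt0// ltr_pwDl//.
    by rewrite divr_gt0// exprn_gt0// mulr_gt0.
  rewrite mulr_ge0 ?sqr_ge0//.
  have := sqr_ge0 Gamma; have : 0 <= (2 * Wb) ^+ 2 * eta by rewrite mulr_ge0 ?sqr_ge0// ltW.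
  by move=> *; lra.
(* The threshold yields [gM]: once ln n >= 1, h^-1 <= 1 + h^-2 = 1 + eta ln n <= (eta^-1 + 1) h^-2,
   so Gamma h^-1 is at most [M n]. *)
have near_m : \forall n \near \oo, Gamma * (eta^-1 + 1) <= m n by move/cvgryPge : m_dvg; exact.
have near_ml : \forall n \near \oo, `|m n| <= 1 * `|ln n%:R|.
  by move/eqoP : m_slow => /(_ 1 ltr01).
have near_l : \forall n \near \oo, expR 1 <= n%:R :> R by exact: nbhs_infty_ger.
have [n0 _ n0P] := filterI near_m (filterI near_ml near_l).
exists A, n0; split=> // n nn0 gamma sigma gG sS rho rhoW nu nuE d T P X iidX c.
have [mG [ml en]] := n0P n nn0.
have n_gt0 : 0 < n%:R :> R by apply: lt_le_trans en; exact: expR_gt0.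
have l1 : 1 <= ln n%:R :> R by rewrite -[leLHS]expRK ler_ln ?posrE ?expR_gt0.
have l0 : 0 < ln n%:R :> R by exact: lt_le_trans l1.
have el : 0 < eta * ln n%:R by rewrite mulr_gt0.
have h0 := bandwidth_gt0 el; have hE := bandwidth_expN2 el.
rewrite mul1r (ger0_norm (ltW l0)) in ml.
have gM : `|gamma| * (bandwidth eta n)^-1 <= M n.
  have hV : (bandwidth eta n)^-1 <= 1 + eta * ln n%:R.
    by rewrite -hE -exprVn; have := sqr_ge0 ((bandwidth eta n)^-1 - 1); set r := _^-1; nra.
  have hV0 : 0 <= (bandwidth eta n)^-1 by rewrite invr_ge0 ltW.
  apply: (@le_trans _ _ (Gamma * (1 + eta * ln n%:R))); first by rewrite ler_pM.
  rewrite M_def hE; apply: (@le_trans _ _ (Gamma * (eta^-1 + 1) * (eta * ln n%:R))).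
    rewrite -mulrA ler_pM2l// mulrDl mul1r lerD2r mulKf ?gt_eqF//.
  by rewrite ler_pM2r.
apply: (le_trans (@symmetric_levy_risk _ w Wb _ _ gamma sigma Gamma Sigma Lambda K beta L _ rho nu
  w_cont Wb0 wW h0 hK hLambda w_moment gM gG sS hE rhoW nuE d T P n X c _ iidX)).
  by rewrite -(ltr0n R).
rewrite lee_fin.
have := @risk_asymptotics R Wb eta Sigma Lambda V Gamma delta beta (ln n%:R) (m n) _ _
  eta0 l1 ml h0 hE (M_def n) (ltW Wb0) (ltW V0) hGamma d0 hbeta erefl gamma gG.
by rewrite lnK ?posrE.
Qed.
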